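(* Let $p$ be a prime number. Up to congruence via a symplectic matrix: 1. If $p\equiv1\bmod 4$, there are exactly $7$ infinite families of normal forms of symmetric $2$-by-$2$ $p$-adic matrices with one degree of freedom, \[\Big\{\Big\{r\begin{pmatrix}1&0\\0&c\end{pmatrix}:r\in\mathbb{Q}_p\Big\}:c\in X_p\Big\},\] and exactly $4$ isolated normal forms, which correspond to $c=0$: \[\Big\{\begin{pmatrix}r&0\\0&0\end{pmatrix}:r\in Y_p\cup\{1\}\Big\}.\] 2. If $p\equiv 3\bmod 4$, there are exactly $5$ infinite families of normal forms of symmetric $2$-by-$2$ $p$-adic matrices with one degree of freedom, given by the same formula (families $\{r\,\mathrm{diag}(1,c):r\in\mathbb{Q}_p\}$ for $c\in X_p$), and exactly $4$ isolated normal forms (the matrices $\mathrm{diag}(r,0)$, $r\in Y_p\cup\{1\}$). 3. If $p=2$, there are exactly $11$ infinite families of normal forms of symmetric $2$-by-$2$ $p$-adic matrices with one degree of freedom, given by the same formula (families $\{r\,\mathrm{diag}(1,c):r\in\mathbb{Q}_2\}$ for $c\in X_2$), and exactly $8$ isolated normal forms (the matrices $\mathrm{diag}(r,0)$, $r\in Y_2\cup\{1\}$). This is in contrast with the real case, where there are exactly $2$ families, elliptic and hyperbolic, and $2$ isolated normal forms.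
   Context: All matrices to be classified are symmetric. Two symmetric matrices $M,M'\in\mathcal{M}_2(\mathbb{Q}_p)$ are congruent via a symplectic matrix if $M'=S^TMS$ for some $S\in\mathcal{M}_2(\mathbb{Q}_p)$ with $S^T\Omega_0S=\Omega_0$, $\Omega_0=\begin{pmatrix}0&1\\-1&0\end{pmatrix}$. An infinite family with $k$ degrees of freedom is a family of normal forms of the form $r_1M_1+\ldots+r_kM_k$ with parameters $r_i\in\mathbb{Q}_p$ (in $\mathbb{R}$ in the real case); an isolated normal form is one which is not part of any such family. If $p\equiv 1\bmod 4$, $c_0$ denotes the smallest quadratic non-residue modulo $p$. The non-residue sets are \[X_p=\begin{cases}\{1,c_0,p,c_0p,c_0^2p,c_0^3p,c_0p^2\} & p\equiv1\bmod 4,\\ \{1,-1,p,-p,p^2\} & p\equiv 3\bmod 4,\\ \{1,-1,2,-2,3,-3,6,-6,12,-18,24\} & p=2,\end{cases}\] \[Y_p=\begin{cases}\{c_0,p,c_0p\} & p\equiv1\bmod 4,\\ \{-1,p,-p\} & p\equiv 3\bmod 4,\\ \{-1,2,-2,3,-3,6,-6\} & p=2.\end{cases}\] *)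

(* Defs.v *)
From HB Require Import structures.
From mathcomp Require Import all_boot all_order all_algebra.
From mathcomp Require Import all_classical all_reals.
Set Implicit Arguments.
Unset Strict Implicit.
Unset Printing Implicit Defensive.
Import Order.TTheory GRing.Theory Num.Theory.
Local Open Scope classical_set_scope.
Local Open Scope card_scope.
Local Open Scope ring_scope.

(* The p-adic numbers: the field of fractions of the inverse limit of the     *)
(* rings Z/p^n. An element of the limit is given by its residues, where       *)
(* [residue x n] is the representative in {0, .., p^n - 1} (the bound follows *)
(* from the compatibility condition).                                         *)

Record padic_int (p : nat) (hp : prime p) := PadicInt {
  residue : nat -> nat;
  residue_compat : forall n, residue n = (residue n.+1 %% p ^ n)%N }.

HB.instance Definition _ p (hp : prime p) := gen_eqMixin (padic_int hp).
HB.instance Definition _ p (hp : prime p) := gen_choiceMixin (padic_int hp).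

Lemma padic_int_ext p (hp : prime p) (x y : padic_int hp) :
  (forall n, residue x n = residue y n) -> x = y.
Proof.
case: x y => [x hx] [y hy] /= /funext exy; subst y.
by congr PadicInt; apply: Prop_irrelevance.
Qed.

Lemma residue_mod p (hp : prime p) (x : padic_int hp) n :
  (residue x n %% p ^ n = residue x n)%N.
Proof. by rewrite residue_compat modn_mod. Qed.

Lemma residueS_mod p (hp : prime p) (x : padic_int hp) n :
  (residue x n.+1 = residue x n %[mod p ^ n])%N.
Proof. by rewrite [in RHS]residue_compat modn_mod. Qed.

Lemma padic_reduce_compat p (f : nat -> nat) :
  (forall n, f n.+1 = f n %[mod p ^ n])%N ->
  forall n, (f n %% p ^ n = (f n.+1 %% p ^ n.+1) %% p ^ n)%N.
Proof. by move=> hf n; rewrite modn_dvdm ?hf // dvdn_exp2l. Qed.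

Definition padic_of p (hp : prime p) (f : nat -> nat)
    (hf : forall n, (f n.+1 = f n %[mod p ^ n])%N) : padic_int hp :=
  PadicInt hp (padic_reduce_compat hf).

Lemma padic_cst_compat p (c : nat) : forall n, (c = c %[mod p ^ n])%N.
Proof. by []. Qed.

Lemma padic_add_compat p (hp : prime p) (x y : padic_int hp) n :
  (residue x n.+1 + residue y n.+1 = residue x n + residue y n %[mod p ^ n])%N.
Proof. by rewrite -modnDm !residueS_mod modnDm. Qed.

Lemma padic_mul_compat p (hp : prime p) (x y : padic_int hp) n :
  (residue x n.+1 * residue y n.+1 = residue x n * residue y n %[mod p ^ n])%N.
Proof. by rewrite -modnMm !residueS_mod modnMm. Qed.

Lemma residue_le p (hp : prime p) (x : padic_int hp) n :
  (residue x n <= p ^ n)%N.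
Proof.
by rewrite -residue_mod ltnW // ltn_mod expn_gt0 prime_gt0.
Qed.

Lemma padic_opp_compat p (hp : prime p) (x : padic_int hp) n :
  (p ^ n.+1 - residue x n.+1 = p ^ n - residue x n %[mod p ^ n])%N.
Proof.
apply/eqP; rewrite -(eqn_modDr (residue x n)) subnK ?residue_le //.
rewrite -modnDmr -residueS_mod modnDmr subnK ?residue_le //.
by rewrite modnn; apply: dvdn_exp2l.
Qed.

Definition padic_zero p (hp : prime p) : padic_int hp :=
  padic_of hp (padic_cst_compat p 0).
Definition padic_one p (hp : prime p) : padic_int hp :=
  padic_of hp (padic_cst_compat p 1).
Definition padic_add p (hp : prime p) (x y : padic_int hp) : padic_int hp :=
  padic_of hp (padic_add_compat x y).
Definition padic_mul p (hp : prime p) (x y : padic_int hp) : padic_int hp :=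
  padic_of hp (padic_mul_compat x y).
Definition padic_opp p (hp : prime p) (x : padic_int hp) : padic_int hp :=
  padic_of hp (padic_opp_compat x).

Lemma padic_addA p (hp : prime p) : associative (@padic_add p hp).
Proof.
by move=> x y z; apply: padic_int_ext => n /=; rewrite modnDml modnDmr addnA.
Qed.

Lemma padic_addC p (hp : prime p) : commutative (@padic_add p hp).
Proof. by move=> x y; apply: padic_int_ext => n /=; rewrite addnC. Qed.

Lemma padic_add0 p (hp : prime p) : left_id (padic_zero hp) (@padic_add p hp).
Proof.
by move=> x; apply: padic_int_ext => n /=; rewrite modnDml residue_mod.
Qed.

Lemma padic_addN p (hp : prime p) :
  left_inverse (padic_zero hp) (@padic_opp p hp) (@padic_add p hp).
Proof.
move=> x; apply: padic_int_ext => n /=.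
by rewrite modnDml subnK ?residue_le // modnn mod0n.
Qed.

HB.instance Definition _ p (hp : prime p) :=
  GRing.isZmodule.Build (padic_int hp)
    (@padic_addA p hp) (@padic_addC p hp) (@padic_add0 p hp) (@padic_addN p hp).

Lemma padic_mulA p (hp : prime p) : associative (@padic_mul p hp).
Proof.
by move=> x y z; apply: padic_int_ext => n /=; rewrite modnMml modnMmr mulnA.
Qed.

Lemma padic_mulC p (hp : prime p) : commutative (@padic_mul p hp).
Proof. by move=> x y; apply: padic_int_ext => n /=; rewrite mulnC. Qed.

Lemma padic_mul1 p (hp : prime p) : left_id (padic_one hp) (@padic_mul p hp).
Proof.
by move=> x; apply: padic_int_ext => n /=; rewrite modnMml mul1n residue_mod.
Qed.

Lemma padic_mulDl p (hp : prime p) :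
  left_distributive (@padic_mul p hp) (@padic_add p hp).
Proof.
move=> x y z; apply: padic_int_ext => n /=.
by rewrite modnMml mulnDl modnDm.
Qed.

Lemma padic_one_neq0 p (hp : prime p) : padic_one hp != padic_zero hp.
Proof.
apply/eqP => /(congr1 (fun x => residue x 1)) /=.
by rewrite mod0n modn_small ?expn1 ?prime_gt1.
Qed.

HB.instance Definition _ p (hp : prime p) :=
  GRing.Zmodule_isComNzRing.Build (padic_int hp)
    (@padic_mulA p hp) (@padic_mulC p hp) (@padic_mul1 p hp)
    (@padic_mulDl p hp) (@padic_one_neq0 p hp).

Definition padic_unit p (hp : prime p) : {pred padic_int hp} :=
  fun x => `[< exists y : padic_int hp, y * x = 1 >].

Definition padic_inv p (hp : prime p) (x : padic_int hp) : padic_int hp :=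
  match pselect (exists y : padic_int hp, y * x = 1) with
  | left h => projT1 (cid h)
  | right _ => x
  end.

Lemma padic_mulV p (hp : prime p) :
  {in @padic_unit p hp, left_inverse 1 (@padic_inv p hp) *%R}.
Proof.
move=> x /asboolP hx; rewrite /padic_inv.
by case: pselect => // h; exact: projT2 (cid h).
Qed.

Lemma padic_unitP p (hp : prime p) (x y : padic_int hp) :
  y * x = 1 -> padic_unit x.
Proof. by move=> h; apply/asboolP; exists y. Qed.

Lemma padic_inv_out p (hp : prime p) :
  {in [predC @padic_unit p hp], @padic_inv p hp =1 id}.
Proof.
move=> x hx; rewrite /padic_inv; case: pselect => // h.
by case/negP: hx; apply/asboolP.
Qed.

HB.instance Definition _ p (hp : prime p) :=
  GRing.ComNzRing_hasMulInverse.Build (padic_int hp)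
    (@padic_mulV p hp) (@padic_unitP p hp) (@padic_inv_out p hp).

Lemma residue_lift p (hp : prime p) (x : padic_int hp) m n :
  (residue x (m + n) = residue x m %[mod p ^ m])%N.
Proof.
elim: n => [|n IH]; first by rewrite addn0.
rewrite addnS -IH -(modn_dvdm _ (dvdn_exp2l p (leq_addr n m))).
by rewrite residueS_mod modn_dvdm // dvdn_exp2l ?leq_addr.
Qed.

Lemma padic_neq0 p (hp : prime p) (x : padic_int hp) : x != 0 ->
  exists m, forall n, ~~ (p ^ m %| residue x (m + n))%N.
Proof.
move=> /eqP nx; have [m hm] : exists m, residue x m <> 0%N.
  apply: contrapT => /forallNP h; apply: nx; apply: padic_int_ext => n /=.
  by rewrite mod0n; apply: contrapT; exact: h.
exists m => n; apply/negP => /eqP; rewrite residue_lift residue_mod; exact: hm.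
Qed.

Lemma padic_integral p (hp : prime p) :
  GRing.integral_domain_axiom (padic_int hp).
Proof.
move=> x y xy0; apply/norP => -[/padic_neq0[a ha] /padic_neq0[b hb]].
have := congr1 (fun z => residue z (a + b)) xy0; rewrite /= mod0n => /eqP.
move: (ha b) (hb a); rewrite [(b + a)%N]addnC.
set u := residue x _; set v := residue y _ => hu hv huv.
have u0 : (0 < u)%N by rewrite lt0n; apply: contraNneq hu => ->.
have v0 : (0 < v)%N by rewrite lt0n; apply: contraNneq hv => ->.
move: hu hv huv; rewrite -/(dvdn _ _) !pfactor_dvdn ?muln_gt0 ?u0 //.
rewrite lognM // -!ltnNge => hu hv.
by rewrite leqNgt -addSn leq_add // ltnW.
Qed.

HB.instance Definition _ p (hp : prime p) :=
  GRing.ComUnitRing_isIntegral.Build (padic_int hp) (@padic_integral p hp).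

Definition padic (p : nat) (hp : prime p) : fieldType := {fraction padic_int hp}.

Definition mx2 (K : fieldType) (a b c d : K) : 'M[K]_2 :=
  \matrix_(i, j) nth 0 (nth [::] [:: [:: a; b]; [:: c; d]] i) j.

Definition Omega0 (K : fieldType) : 'M[K]_2 := mx2 0 1 (-1) 0.

Definition symmetric (K : fieldType) : set 'M[K]_2 := [set M | M^T = M].

Definition symplectic (K : fieldType) (S : 'M[K]_2) : Prop :=
  S^T *m Omega0 K *m S = Omega0 K.

Definition congruent (K : fieldType) (M M' : 'M[K]_2) : Prop :=
  exists S, symplectic S /\ M' = S^T *m M *m S.

Definition congr_class (K : fieldType) (M : 'M[K]_2) : set 'M[K]_2 :=
  [set M' | congruent M M'].

(* A family with k degrees of freedom whose members are all in N. The k       *)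
(* parameters are independent, and the family is infinite even when its       *)
(* members are counted up to congruence.                                      *)
Definition infinite_family (K : fieldType) (N : set 'M[K]_2) (k : nat)
    (F : set 'M[K]_2) : Prop :=
  exists Ms : 'I_k -> 'M[K]_2,
    let comb (r : {ffun 'I_k -> K}) := \sum_i r i *: Ms i in
    [/\ F = range comb, injective comb, F `<=` N &
        infinite_set (@congr_class K @` F)].

Definition isolated (K : fieldType) (N : set 'M[K]_2) (M : 'M[K]_2) : Prop :=
  N M /\ forall k F, infinite_family N k F -> ~ F M.

Definition diag_family (K : fieldType) (c : K) : set 'M[K]_2 :=
  [set r *: mx2 1 0 0 c | r in [set: K]].

Definition normal_forms (K : fieldType) (X Y : seq K) : set 'M[K]_2 :=
  [set M | (exists2 c, c \in X & diag_family c M) \/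
           (exists2 r, r \in Y & M = mx2 r 0 0 0)].

(* Up to congruence, there are exactly n infinite families with one degree of *)
(* freedom, the r * diag(1, c) for c in X, and exactly m isolated normal      *)
(* forms, the diag(r, 0) for r in Y. The zero matrix is a member of every     *)
(* family; two different families have no other member in common, even up to  *)
(* congruence.                                                                *)
Record classification (K : fieldType) (X Y : seq K) (n m : nat) : Prop := {
  normal_forms_complete : forall M, symmetric M ->
    exists2 M', normal_forms X Y M' & congruent M M';
  families_eq :
    [set F | infinite_family (normal_forms X Y) 1 F] =
    [set diag_family c | c in [set` X]];
  families_card :
    [set F | infinite_family (normal_forms X Y) 1 F] #= `I_n;
  families_irredundant : forall F F' M M',
    infinite_family (normal_forms X Y) 1 F ->
    infinite_family (normal_forms X Y) 1 F' -> F <> F' ->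
    F M -> F' M' -> congruent M M' -> M = 0;
  families_exhaustive : forall F, infinite_family (@symmetric K) 1 F ->
    exists2 F', infinite_family (normal_forms X Y) 1 F' &
      @congr_class K @` F = @congr_class K @` F';
  isolated_eq :
    [set M | isolated (normal_forms X Y) M] =
    [set mx2 r 0 0 0 | r in [set` Y]];
  isolated_card : [set M | isolated (normal_forms X Y) M] #= `I_m;
  isolated_irredundant : forall M M', isolated (normal_forms X Y) M ->
    normal_forms X Y M' -> congruent M M' -> M = M' }.

(* 0 counts as a square here, so the search below never returns it; the       *)
(* index found by find in iota 0 p is the residue itself.                     *)
Definition square_mod (p c : nat) : bool :=
  [exists x : 'I_p, x ^ 2 == c %[mod p]]%N.

Definition least_nonresidue (p : nat) : nat :=
  find (fun c => ~~ square_mod p c) (iota 0 p).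

(* Only used for p prime, so that the last case is p = 2. *)
Definition nonresidue_X (K : fieldType) (p : nat) : seq K :=
  let q : K := p%:R in
  let c0 : K := (least_nonresidue p)%:R in
  if (p %% 4 == 1)%N then
    [:: 1; c0; q; c0 * q; c0 ^+ 2 * q; c0 ^+ 3 * q; c0 * q ^+ 2]
  else if (p %% 4 == 3)%N then [:: 1; -1; q; - q; q ^+ 2]
  else [:: 1; -1; 2; -2; 3; -3; 6; -6; 12; -18; 24].

Definition nonresidue_Y (K : fieldType) (p : nat) : seq K :=
  let q : K := p%:R in
  let c0 : K := (least_nonresidue p)%:R in
  if (p %% 4 == 1)%N then [:: c0; q; c0 * q]
  else if (p %% 4 == 3)%N then [:: -1; q; - q]
  else [:: -1; 2; -2; 3; -3; 6; -6].

(* Main.v *)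
From HB Require Import structures.
Require Import Defs.
From mathcomp Require Import all_boot all_order all_algebra.
From mathcomp Require Import all_fingroup all_solvable all_field.
From mathcomp Require Import all_classical all_reals.
From mathcomp Require Import ring.
Set Implicit Arguments.
Unset Strict Implicit.
Unset Printing Implicit Defensive.
Import Order.TTheory GRing.Theory Num.Theory.
Local Open Scope classical_set_scope.
Local Open Scope card_scope.
Local Open Scope ring_scope.

(** In dimension two "symplectic" means "of determinant 1". A nondegenerate form diag(e, f) is
    congruent to diag(e', f') if and only if the determinants agree and e' is represented by
    diag(e, f), so the classes of determinant d are the cosets in K^* of the group
    N_d = {u^2 + d v^2 <> 0} of norms from K(sqrt(-d)). The form r * diag(1, c) has determinant
    r^2 c and lies in the coset r N_c, so for each square class of determinants one needs enough
    c = t^2 y in that class for the cosets of the t and of the -t to exhaust K^* / N_y. Over Q_p,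
    where this quotient has order at most 2, that is one value if N_y = K^* or if -1 is not in
    N_y, and two otherwise. Existence of representations comes from square roots of units (a
    fixed point of a contraction of Z_p), and their absence from infinite descent on ternary
    quadratic forms, modulo p for odd p and modulo 16 for p = 2. *)

(** * Symplectic congruence of 2 x 2 matrices *)

Section Matrices.
Variable K : fieldType.
Implicit Types (a b c d e f r x y : K) (M S : 'M[K]_2).

Lemma mx2P (P : 'M[K]_2 -> Prop) : (forall a b c d, P (mx2 a b c d)) -> forall M, P M.
Proof.
move=> h M; suff -> : M = mx2 (M 0 0) (M 0 1) (M 1 0) (M 1 1) by [].
apply/matrixP => i j; rewrite mxE.
by case: i => [[|[|//]] ?]; case: j => [[|[|//]] ?] /=; congr (M _ _); apply/val_inj.
Qed.

Lemma mx2_inj a b c d a' b' c' d' :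
  mx2 a b c d = mx2 a' b' c' d' -> [/\ a = a', b = b', c = c' & d = d'].
Proof.
by move=> /matrixP h; split; [move: (h 0 0)|move: (h 0 1)|move: (h 1 0)|move: (h 1 1)];
  rewrite !mxE.
Qed.

Lemma tr_mx2 a b c d : (mx2 a b c d)^T = mx2 a c b d.
Proof.
apply/matrixP => i j; rewrite !mxE.
by case: i => [[|[|//]] ?]; case: j => [[|[|//]] ?].
Qed.

Lemma scale_mx2 r a b c d : r *: mx2 a b c d = mx2 (r * a) (r * b) (r * c) (r * d).
Proof.
apply/matrixP => i j; rewrite !mxE.
by case: i => [[|[|//]] ?]; case: j => [[|[|//]] ?].
Qed.

Lemma mx2_0 : mx2 0 0 0 0 = 0 :> 'M[K]_2.
Proof. by rewrite -(scale0r (mx2 0 0 0 0)) scale_mx2 !mulr0. Qed.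

Lemma mul_mx2 a b c d a' b' c' d' : mx2 a b c d *m mx2 a' b' c' d' =
  mx2 (a * a' + b * c') (a * b' + b * d') (c * a' + d * c') (c * b' + d * d').
Proof.
apply/matrixP => i j; rewrite !mxE !big_ord_recr big_ord0 /= add0r !mxE.
by case: i => [[|[|//]] ?]; case: j => [[|[|//]] ?].
Qed.

Lemma det_mx2 a b c d : \det (mx2 a b c d) = a * d - b * c.
Proof.
rewrite (expand_det_row _ 0) !big_ord_recr big_ord0 /= add0r /cofactor !det_mx11.
by rewrite !mxE /= expr0 expr1 mul1r mulN1r mulrN.
Qed.

(** In dimension two [S^T *m Omega0 K *m S] is again alternating, and its upper right entry is the
    determinant of [S]. *)
Lemma symplectic_det S : symplectic S <-> \det S = 1.
Proof.
move: S; apply: mx2P => a b c d; rewrite /symplectic /Omega0 tr_mx2 !mul_mx2 det_mx2.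
split=> [/mx2_inj[_ <- _ _]|h]; first by ring.
by congr mx2; rewrite -?[in RHS]h; ring.
Qed.

Lemma congruent_refl M : congruent M M.
Proof.
by exists 1%:M; rewrite trmx1 mul1mx mulmx1; split=> //; apply/symplectic_det; rewrite det1.
Qed.

Lemma congruent_trans M M' M'' : congruent M M' -> congruent M' M'' -> congruent M M''.
Proof.
move=> [S [/symplectic_det hS ->]] [T [/symplectic_det hT ->]]; exists (S *m T); split.
  by apply/symplectic_det; rewrite det_mulmx hS hT mulr1.
by rewrite trmx_mul !mulmxA.
Qed.

Lemma congruent_sym M M' : congruent M M' -> congruent M' M.
Proof.
move=> [S [/symplectic_det hS ->]]; have uS : S \in unitmx by rewrite unitmxE hS unitr1.
exists (invmx S); split; first by apply/symplectic_det; rewrite det_inv hS invr1.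
by rewrite trmx_inv !mulmxA mulVmx ?unitmx_tr // mul1mx mulmxK.
Qed.

Lemma congruent_det M M' : congruent M M' -> \det M = \det M'.
Proof.
move=> [S [/symplectic_det hS ->]].
by rewrite !det_mulmx det_tr hS mulr1 mul1r.
Qed.

Lemma congruent_scale r M M' : congruent M M' -> congruent (r *: M) (r *: M').
Proof.
move=> [S [hS ->]]; exists S; split=> //.
by rewrite -scalemxAr -scalemxAl.
Qed.

Lemma congr_class_eq M M' : congruent M M' <-> congr_class M = congr_class M'.
Proof.
split=> [h|h]; last by suff : congr_class M M' by []; rewrite h; exact: congruent_refl.
apply/seteqP; split=> N /=.
  by apply: congruent_trans; apply: congruent_sym.
exact: congruent_trans.
Qed.

(** A vector [(x, y)] of value [e'] becomes the first column; the second is orthogonal to it for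
    diag(e, f) and scaled to make the determinant 1. Equality of determinants then forces the second
    value to be [f']. *)
Lemma congruent_diag e f e' f' x y : e' != 0 -> e' = e * x ^+ 2 + f * y ^+ 2 ->
  e * f = e' * f' -> congruent (mx2 e 0 0 f) (mx2 e' 0 0 f').
Proof.
move=> e0 he hd; exists (mx2 x (- (f * y / e')) y (e * x / e')); split.
  apply/symplectic_det; rewrite det_mx2.
  have -> : x * (e * x / e') - - (f * y / e') * y = (e * x ^+ 2 + f * y ^+ 2) / e' by ring.
  by rewrite -he divff.
rewrite tr_mx2 !mul_mx2; congr mx2.
- by rewrite he; ring.
- by ring.
- by ring.
have -> : (- (f * y / e') * e + e * x / e' * 0) * - (f * y / e')
  + (- (f * y / e') * 0 + e * x / e' * f) * (e * x / e') =
  e * f * (e * x ^+ 2 + f * y ^+ 2) / e' / e' by ring.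
by rewrite -he hd; field.
Qed.

Lemma congruent_diag_inv e f e' f' : congruent (mx2 e 0 0 f) (mx2 e' 0 0 f') ->
  e * f = e' * f' /\ exists x y, e' = e * x ^+ 2 + f * y ^+ 2.
Proof.
move=> h; split.
  by have := congruent_det h; rewrite !det_mx2 !mulr0 !subr0.
move: h => [S [_]]; move: S; apply: mx2P => a b c d.
rewrite tr_mx2 !mul_mx2 => /mx2_inj[-> _ _ _]; exists a, c; ring.
Qed.

(** If [a] is nonzero, complete the square. Otherwise a quarter turn brings a nonzero [d] to first
    place, or a shear creates a nonzero first entry. Only the zero matrix can leave [e = 0]. *)
Lemma symmetric_diag M : 2 != 0 :> K -> Defs.symmetric M ->
  exists e f, congruent M (mx2 e 0 0 f) /\ (M != 0 -> e != 0).
Proof.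
move=> two0; move: M; apply: mx2P => a b c d;
rewrite /Defs.symmetric /= tr_mx2 => /mx2_inj[_ -> _ _] {c}.
have diag (a1 b1 d1 : K) : a1 != 0 -> congruent (mx2 a1 b1 b1 d1) (mx2 a1 0 0 (d1 - b1 ^+ 2 / a1)).
  move=> a0; exists (mx2 1 (- (b1 / a1)) 0 1); split.
    by apply/symplectic_det; rewrite det_mx2; ring.
  by rewrite tr_mx2 !mul_mx2; congr mx2; field.
have [->|a0] := eqVneq a 0; last by do 2 eexists; split; [apply: diag|].
have [->|d0] := eqVneq d 0; last first.
  exists d, (0 - (- b) ^+ 2 / d); split=> //; apply: congruent_trans (diag _ _ _ d0).
  exists (mx2 0 1 (-1) 0); split; first by apply/symplectic_det; rewrite det_mx2; ring.
  by rewrite tr_mx2 !mul_mx2; congr mx2; ring.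
have [->|b0] := eqVneq b 0.
  exists 0, 0; split; first exact: congruent_refl.
  by rewrite mx2_0 eqxx.
(* With both diagonal entries zero, the sum of the two basis vectors has value 2b. *)
have b20 : 2 * b != 0 by rewrite mulf_neq0.
do 2 eexists; split; last by move=> _; exact: b20.
apply: congruent_trans (diag _ b 0 b20).
exists (mx2 1 0 1 1); split; first by apply/symplectic_det; rewrite det_mx2; ring.
by rewrite tr_mx2 !mul_mx2; congr mx2; ring.
Qed.

End Matrices.

(** * Classification from representatives of norm cosets *)

Lemma card_image_seq (T : choiceType) (U : Type) (f : T -> U) (s : seq T) :
  uniq s -> {in s &, injective f} ->
  [set f x | x in [set` s]] #= `I_(size s).
Proof.
case: s => [|x0 s] us injf.
  by rewrite (_ : [set` [::]] = set0) ?image_set0 ?card_eq00 ?II0 //; apply/seteqP; split.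
set t := x0 :: s in us injf *.
rewrite (_ : image _ _ = (f \o nth x0 t) @` `I_(size t)).
  apply: inj_card_eq => i j /[!inE] hi hj /= /injf.
  by rewrite !mem_nth // => /(_ isT isT)/eqP; rewrite nth_uniq // => /eqP.
apply/seteqP; split=> [_ [x xt <-]|_ [i hi <-]]; last first.
  by exists (nth x0 t i) => //; apply: mem_nth.
by exists (index x t); [exact: etrans (index_mem x t) xt|rewrite /comp nth_index].
Qed.

Lemma infinite_set_inj (T : Type) (A : set T) (f : nat -> T) :
  injective f -> (forall n, A (f n)) -> infinite_set A.
Proof.
move=> injf fA finA; apply: infinite_nat.
have : finite_set (f @` setT) by apply: sub_finite_set finA => _ [n _ <-].
by rewrite (eq_finite_set (inj_card_eq (in2W injf))).
Qed.

(** * One-parameter families as lines of matrices *)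

Section Families.
Variable K : fieldType.
Implicit Types (N F : set 'M[K]_2) (M : 'M[K]_2).

Lemma infinite_family_scale N k F M r :
  infinite_family N k F -> F M -> F (r *: M).
Proof.
move=> [Ms [-> _ _ _]] [s _ <-]; exists [ffun i => r * s i] => //.
by rewrite scaler_sumr; apply: eq_bigr => i _; rewrite ffunE scalerA.
Qed.

(** With one parameter, injectivity of the parametrisation says exactly that the generator is
    nonzero. *)
Lemma infinite_family1P N F : infinite_family N 1 F <->
  exists M, [/\ M != 0, F = range ( *:%R^~ M), F `<=` N & infinite_set (@congr_class K @` F)].
Proof.
split=> [[Ms [FE inj FN inf]]|[M [M0 FE FN inf]]].
  exists (Ms 0); split=> //.
    apply/eqP => Ms0; suff /ffunP/(_ 0) : [ffun _ => 1] = [ffun _ => 0] :> {ffun 'I_1 -> K}.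
      by rewrite !ffunE => /eqP; rewrite oner_eq0.
    by apply: inj; rewrite !big_ord1 Ms0 !scaler0.
  rewrite FE; apply/seteqP; split=> _ [r _ <-]; first by exists (r 0); rewrite ?big_ord1.
  by exists [ffun _ => r]; rewrite ?big_ord1 ?ffunE.
exists (fun=> M); split=> //.
  rewrite FE; apply/seteqP; split=> _ [r _ <-]; last by exists (r 0); rewrite ?big_ord1.
  by exists [ffun _ => r]; rewrite ?big_ord1 ?ffunE.
move=> r s; rewrite !big_ord1 => /eqP; rewrite -subr_eq0 -scalerBl scaler_eq0 (negPf M0) orbF.
by rewrite subr_eq0 => /eqP rs; apply/ffunP => i; rewrite (ord1 i).
Qed.

End Families.

Section Classification.
Variable K : fieldType.

(* Y has one member in each square class of K^*, and (y, t) in L stands for the family of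
   diag(1, t^2 y). The values u^2 + y v^2 are the norms from K(sqrt(-y)). The conditions on
   them are squared because r and -r give r * diag(1, c) the same determinant, so that the
   twists t only count up to sign. *)
Record norm_reps (Y : seq K) (L : seq (K * K)) : Prop := NormReps {
  reps_char0 : injective (fun n : nat => n%:R : K);
  reps_uniq : uniq Y;
  reps_neq0 : 0 \notin Y;
  reps_total : forall a, a != 0 -> exists2 y, y \in Y & exists s, a = s ^+ 2 * y;
  reps_square : forall y y' s, y \in Y -> y' \in Y -> y' = s ^+ 2 * y -> y' = y;
  twists_uniq : uniq L;
  twists_mem : forall y t, (y, t) \in L -> y \in Y /\ t != 0;
  twists_total : forall y a, y \in Y -> a \in Y ->
    exists t u v, (y, t) \in L /\ (t * a) ^+ 2 = (u ^+ 2 + y * v ^+ 2) ^+ 2;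
  twists_norm : forall y t t' u v, (y, t) \in L -> (y, t') \in L ->
    t' ^+ 2 = (u ^+ 2 + y * v ^+ 2) ^+ 2 * t ^+ 2 -> t' = t }.

Variables (Y : seq K) (L : seq (K * K)).
Hypothesis rL : norm_reps Y L.

Let X := [seq l.2 ^+ 2 * l.1 | l <- L].
Let NF := normal_forms X Y.

Let two_neq0 : 2 != 0 :> K.
Proof. by apply/eqP => /(reps_char0 rL (x1 := 2%N) (x2 := 0%N)). Qed.

Lemma reps_mem_neq0 y : y \in Y -> y != 0.
Proof. by apply: contraTneq => ->; rewrite (reps_neq0 rL). Qed.

Lemma memXP c : c \in X -> exists y t, [/\ (y, t) \in L, y \in Y, t != 0 & c = t ^+ 2 * y].
Proof. by case/mapP=> -[y t] /= h ->; have [? ?] := twists_mem rL h; exists y, t. Qed.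

Lemma memX_neq0 c : c \in X -> c != 0.
Proof.
case/memXP => y [t [_ /reps_mem_neq0 y0 t0 ->]].
by rewrite mulf_neq0 ?expf_neq0.
Qed.

(** For congruent forms r diag(1, t^2 y) and r' diag(1, t'^2 y'), [s] stands for r'/r. The
    determinants give the square class, hence y = y'; then [s] is a norm with t^2 = s^2 t'^2, which
    [twists_norm] allows only for equal twists. *)
Lemma twists_inj y t y' t' s u v : (y, t) \in L -> (y', t') \in L -> s != 0 ->
  t ^+ 2 * y = s ^+ 2 * (t' ^+ 2 * y') ->  s = u ^+ 2 + t ^+ 2 * y * v ^+ 2 ->
  (y, t) = (y', t').
Proof.
move=> h h' s0 hd hs; have [yY t0] := twists_mem rL h; have [yY' t0'] := twists_mem rL h'.
have eyy' : y = y'.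
  apply: (reps_square rL (s := s * t' / t)) => //.
  by apply: (mulfI (expf_neq0 2 t0)); rewrite hd; field.
subst y'; congr pair.
apply: (twists_norm rL (u := u) (v := t * v) h' h).
have -> : u ^+ 2 + y * (t * v) ^+ 2 = s by rewrite hs; ring.
by apply: (mulIf (reps_mem_neq0 yY)); rewrite hd mulrA.
Qed.

Lemma memX_uniq : uniq X.
Proof.
rewrite map_inj_in_uniq ?(twists_uniq rL) // => -[y t] [y' t'] /= h h' e.
by apply: (twists_inj (s := 1) (u := 1) (v := 0) h h'); rewrite ?oner_neq0 // ?e; ring.
Qed.

Lemma diag_families_disjoint c c' r r' : c \in X -> c' \in X -> r != 0 ->
  congruent (r *: mx2 1 0 0 c) (r' *: mx2 1 0 0 c') -> c = c'.
Proof.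
move=> hc hc' r0; rewrite !scale_mx2 !mulr0 !mulr1 => /congruent_diag_inv[hd [u [v hr]]].
case/mapP: (hc) => -[y t] h /= ec; case/mapP: (hc') => -[y' t'] h' /= ec'.
have r0' : r' != 0.
  apply: contraTneq (memX_neq0 hc) => r0'; move/eqP: hd.
  by rewrite r0' mul0r !mulf_eq0 (negPf r0) /= negbK.
rewrite ec ec'; suff [-> ->] : (y, t) = (y', t') by [].
apply: (twists_inj (s := r' / r) (u := u) (v := v) h h'); first by rewrite mulf_neq0 ?invr_eq0.
  rewrite -ec -ec'; apply: (mulfI r0); apply: (mulfI r0); rewrite hd; field.
  exact: r0.
by rewrite -ec hr; field.
Qed.

(** After diagonalisation, a nonzero determinant e f = s^2 y is also that of (s / t) diag(1, t^2 y)
    for every twist t, so it remains to choose t such that the first coefficients differ by a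
    norm. *)
Lemma normal_form_exists M : Defs.symmetric M -> exists2 M', NF M' & congruent M M'.
Proof.
move=> /(symmetric_diag two_neq0)[e [f [Mef e0]]].
(* The zero matrix lies in every family; [twists_total] merely supplies some pair of [L]. *)
have [M0|/e0{}e0] := eqVneq M 0.
  have [y yY _] := reps_total rL (oner_neq0 K).
  have [t [_ [_ [h _]]]] := twists_total rL yY yY.
  exists 0; last by rewrite M0; apply: congruent_refl.
  by left; exists (t ^+ 2 * y); [apply/mapP; exists (y, t)|exists 0; rewrite ?scale0r].
have [f0|f0] := eqVneq f 0.
  have [y yY [s es]] := reps_total rL e0.
  exists (mx2 y 0 0 0); first by right; exists y.
  apply: congruent_trans Mef _; rewrite f0.
  have s0 : s != 0 by apply: contraNneq e0 => s0; rewrite es s0 expr0n mul0r.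
  apply: (congruent_diag (x := s^-1) (y := 0)); rewrite ?reps_mem_neq0 ?mulr0 //.
  by rewrite es; field.
have [y yY [s es]] := reps_total rL (mulf_neq0 e0 f0).
have s0 : s != 0.
  by apply/eqP => s0; move/eqP: es; rewrite s0 expr0n mul0r mulf_eq0 (negPf e0) (negPf f0).
(* Modulo squares (s / t) / e is t e s, so only the class [a] of e s matters for the choice of the
   twist. *)
have [a aY [w ew]] := reps_total rL (mulf_neq0 e0 s0).
have [t [u [v [h /eqP]]]] := twists_total rL yY aY.
have [_ t0] := twists_mem rL h.
(* Here [t1] is t or -t, with the sign for which [t1 * a] itself is a norm; the parameter t^2 y does
   not depend on it. *)
suff key t1 : t1 ^+ 2 = t ^+ 2 -> t1 * a = u ^+ 2 + y * v ^+ 2 ->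
    exists2 M', NF M' & congruent M M'.
  rewrite eqf_sqr => /orP[/eqP|]; first exact: key.
  by rewrite eq_sym eqr_oppLR => /eqP ht; apply: (key (- t)); rewrite ?sqrrN // ht mulNr.
move=> tt ta; have t10 : t1 != 0 by rewrite -sqrf_eq0 tt sqrf_eq0.
exists (s / t1 *: mx2 1 0 0 (t ^+ 2 * y)).
  by left; exists (t ^+ 2 * y); [apply/mapP; exists (y, t)|exists (s / t1)].
apply: congruent_trans Mef _; apply: congruent_sym.
rewrite scale_mx2 !mulr0 mulr1.
(* These coordinates give (s / t1) (x^2 + t^2 y y'^2) = w^2 (u^2 + y v^2) / (s t1) = w^2 a / s = e,
   where y' is the second coordinate. *)
apply: (congruent_diag (x := u * w / s) (y := v * w / (s * t1))) => //.
  apply: (mulIf s0); rewrite ew.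
  have -> : a = (u ^+ 2 + y * v ^+ 2) / t1 by rewrite -ta; field.
  by rewrite -tt; field; rewrite s0 t10.
by rewrite es -tt; field.
Qed.

(** The multiples by natural numbers n have determinants n^2 c, which are distinct in characteristic
    zero. *)
Lemma diag_family_infinite c : c != 0 -> infinite_set (@congr_class K @` diag_family c).
Proof.
move=> c0; apply: (@infinite_set_inj _ _ (fun n : nat => congr_class (n%:R *: mx2 1 0 0 c))).
  move=> m n /congr_class_eq/congruent_det.
  rewrite !scale_mx2 !det_mx2 !mulr0 !subr0 !mulr1 !mulrA -!expr2 => /(mulIf c0).
  rewrite -!natrX => /(reps_char0 rL)/eqP; rewrite eqn_exp2r // => /eqP //.
by move=> n; exists (n%:R *: mx2 1 0 0 c) => //; exists n%:R.
Qed.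

Lemma diag_family_infinite_family c : c \in X -> infinite_family NF 1 (diag_family c).
Proof.
move=> cX; apply/infinite_family1P; exists (mx2 1 0 0 c); split=> //.
- by rewrite -mx2_0; apply/eqP => /mx2_inj[/eqP]; rewrite oner_eq0.
- by move=> M cM; left; exists c.
- exact/diag_family_infinite/memX_neq0.
Qed.

Lemma degenerate_normal_form M : NF M -> \det M = 0 -> exists2 y, y \in 0 :: Y & M = mx2 y 0 0 0.
Proof.
case=> [[c cX [r _ <-]]|[y yY ->] _]; last by exists y; rewrite ?inE ?yY ?orbT.
rewrite scale_mx2 det_mx2 !mulr0 subr0 mulr1 => /eqP.
rewrite !mulf_eq0 (negPf (memX_neq0 cX)) orbF orbb => /eqP ->.
by exists 0; rewrite ?inE ?eqxx // mul0r.
Qed.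

(** A family contains all multiples of its members. Those of diag(y, 0) are infinitely many
    degenerate matrices, whereas only finitely many normal forms are degenerate. *)
Lemma degenerate_not_family k F y : y \in Y -> infinite_family NF k F -> ~ F (mx2 y 0 0 0).
Proof.
move=> yY hF Fy.
apply: (@infinite_set_inj _ [set` 0 :: Y] (fun n : nat => n%:R * y)) => //.
  by move=> m n /(mulIf (reps_mem_neq0 yY))/(reps_char0 rL).
move=> n /=; have [_ [_ _ FN _]] := hF.
have := FN _ (infinite_family_scale n%:R hF Fy); rewrite scale_mx2 !mulr0.
case/degenerate_normal_form=> [|z hz /mx2_inj[-> //]].
by rewrite det_mx2 !mulr0 subr0.
Qed.

Lemma infinite_family_diag F : infinite_family NF 1 F <-> exists2 c, c \in X & F = diag_family c.
Proof.
split=> [hF|[c cX ->]]; last exact: diag_family_infinite_family.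
have [M [M0 FE FN inf]] := (infinite_family1P _ _).1 hF.
have FM : F M by rewrite FE; exists 1; rewrite ?scale1r.
have [[c cX [r _ rM]]|[y yY My]] := FN _ FM; last first.
  by case: (degenerate_not_family yY hF); rewrite -My.
exists c => //; rewrite FE -rM; have r0 : r != 0.
  by apply: contraNneq M0 => r0; rewrite -rM r0 scale0r.
apply/seteqP; split=> _ [s _ <-]; first by exists (s * r); rewrite ?scalerA.
by exists (s / r) => //; rewrite scalerA mulfVK.
Qed.

Lemma diag_family_inj : injective (@diag_family K).
Proof.
move=> c c' cc; have : diag_family c' (mx2 1 0 0 c) by rewrite -cc; exists 1; rewrite ?scale1r.
by move=> [r _]; rewrite scale_mx2 mulr1 => /mx2_inj[-> _ _]; rewrite mul1r.
Qed.

(** A degenerate generator would leave only finitely many congruence classes on its line. Otherwise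
    its normal form is r diag(1, c) with r nonzero, and the congruence passes to all multiples. *)
Lemma infinite_family_symmetric F : infinite_family (@Defs.symmetric K) 1 F ->
  exists2 F', infinite_family NF 1 F' & @congr_class K @` F = @congr_class K @` F'.
Proof.
case/infinite_family1P => M [M0 FE Fs inf].
have FM : F M by rewrite FE; exists 1; rewrite ?scale1r.
have [M' NM' MM'] := normal_form_exists (Fs _ FM).
have dM : \det M != 0.
  apply/eqP => dM; apply: inf.
  apply: (@sub_finite_set _ _ [set congr_class (mx2 y 0 0 0) | y in [set` 0 :: Y]]).
    move=> _ [N FN <-]; have [N' NN' hN'] := normal_form_exists (Fs _ FN).
    have [|y yY hy] := degenerate_normal_form NN'.
      rewrite -(congruent_det hN'); move: FN; rewrite FE => -[r _ <-].
      by rewrite detZ dM mulr0.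
    by exists y => //; rewrite -hy; apply/esym/congr_class_eq.
  exact: finite_image.
case: NM' => [[c cX [r _ rM']]|[y yY M'y]]; last first.
  by case/eqP: dM; rewrite (congruent_det MM') M'y det_mx2 !mulr0 subr0.
exists (diag_family c); first exact: diag_family_infinite_family.
have r0 : r != 0.
  apply: contraNneq dM => r0.
  by rewrite (congruent_det MM') -rM' r0 scale0r det0.
rewrite -rM' in MM'; rewrite FE; apply/seteqP; split=> _ [_ [s _ <-] <-].
  exists (s * r *: mx2 1 0 0 c); first by exists (s * r).
  by rewrite -scalerA; apply/esym/congr_class_eq/congruent_scale.
exists (s / r *: M); first by exists (s / r).
have -> : s *: mx2 1 0 0 c = s / r *: (r *: mx2 1 0 0 c) by rewrite scalerA mulfVK.
exact/congr_class_eq/congruent_scale.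
Qed.

Lemma isolatedP M : isolated NF M <-> exists2 y, y \in Y & M = mx2 y 0 0 0.
Proof.
split=> [[[[c cX cM]|//] iso]|[y yY ->]].
  by case: (iso _ _ (diag_family_infinite_family cX)).
split; first by right; exists y.
by move=> k F hF; apply: degenerate_not_family hF.
Qed.

(** The form diag(y, 0) represents only y times squares, so congruence preserves the square class of
    y. *)
Lemma isolated_congruent M M' : isolated NF M -> NF M' -> congruent M M' -> M = M'.
Proof.
move=> /isolatedP[y yY ->] NM' hM'; have [|y' yY' eM'] := degenerate_normal_form NM'.
  by rewrite -(congruent_det hM') det_mx2 !mulr0 subr0.
move: hM'; rewrite eM' => hM'.
have [_ [u [v ey]]] := congruent_diag_inv hM'; rewrite mul0r addr0 mulrC in ey.
move: yY'; rewrite inE => /orP[/eqP y'0|yY']; last by rewrite (reps_square rL yY yY' ey).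
have [_ [u' [v']]] := congruent_diag_inv (congruent_sym hM').
rewrite y'0 !mul0r addr0 => y0.
by move: (reps_neq0 rL); rewrite -y0 yY.
Qed.

Lemma norm_reps_classification : classification X Y (size L) (size Y).
Proof.
have famE : [set F | infinite_family NF 1 F] = [set diag_family c | c in [set` X]].
  apply/seteqP; split=> F /=; first by move=> /infinite_family_diag[c cX ->]; exists c.
  by move=> [c cX <-]; apply: diag_family_infinite_family.
have isoE : [set M | isolated NF M] = [set mx2 r 0 0 0 | r in [set` Y]].
  apply/seteqP; split=> M /=; first by move=> /isolatedP[y yY ->]; exists y.
  by move=> [y yY <-]; apply/isolatedP; exists y.
split=> //.
- exact: normal_form_exists.
- rewrite famE -(size_map (fun l => l.2 ^+ 2 * l.1) L).
  by apply: card_image_seq memX_uniq (in2W diag_family_inj).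
- move=> F F' M M' /infinite_family_diag[c cX ->] /infinite_family_diag[c' cX' ->] FF'.
  move=> [r _ <-] [r' _ <-] h; have [->|r0] := eqVneq r 0; first by rewrite scale0r.
  by case: FF'; rewrite (diag_families_disjoint cX cX' r0 h).
- exact: infinite_family_symmetric.
- rewrite isoE; apply: card_image_seq (reps_uniq rL) _.
  by move=> a b _ _ /mx2_inj[].
- exact: isolated_congruent.
Qed.

End Classification.

(** * Residues and fixed points in Z_p *)

Lemma fraction_denominator (R : idomainType) (x : {fraction R}) :
  exists d n : R, d != 0 /\ x * tofrac d = tofrac n.
Proof.
elim/quotW: x => r; exists \d_r, \n_r; split; first exact: denom_ratioP.
rewrite -[LHS]/(FracField.mul _ _) !piE; apply/eqmodP.
rewrite /= FracField.equivfE /FracField.mulf !numden_Ratio ?mulf_neq0 ?oner_neq0 ?denom_ratioP //.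
by rewrite !mulr1 mulrC.
Qed.

Section PadicIntegers.
Variables (p : nat) (hp : prime p).
Implicit Types x y z : padic_int hp.

Lemma residue_nat k n : residue (k%:R : padic_int hp) n = (k %% p ^ n)%N.
Proof.
elim: k => [//|k IH]; rewrite -addn1 natrD.
by rewrite -[LHS]/((residue (k%:R : padic_int hp) n + 1 %% p ^ n) %% p ^ n)%N IH modnDm.
Qed.

Lemma residue_mul x y n : residue (x * y) n = ((residue x n * residue y n) %% p ^ n)%N.
Proof. by []. Qed.

Lemma residue_add x y n : residue (x + y) n = ((residue x n + residue y n) %% p ^ n)%N.
Proof. by []. Qed.

Lemma residue_eq0P x n : residue x n = 0%N <-> exists y, x = p%:R ^+ n * y.
Proof.
split=> [x0|[y ->]]; last first.
  by rewrite residue_mul -natrX residue_nat modnn mul0n mod0n.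
(* The quotient by p^n is read off from the residues of [x] shifted by n places. *)
have compat m : (residue x (n + m) %/ p ^ n =
    (residue x (n + m.+1) %/ p ^ n) %% p ^ m)%N.
  by rewrite modn_divl -expnD addnC addnS addnC [in LHS]residue_compat addnC.
exists (PadicInt hp compat); apply: padic_int_ext => m.
rewrite -natrX residue_mul residue_nat modnMml /= mulnC divnK.
  by rewrite [(n + m)%N]addnC residue_lift residue_mod.
by rewrite /dvdn residue_lift x0 mod0n.
Qed.

Lemma residue_eqP x y n : residue x n = residue y n <-> exists z, x = y + p%:R ^+ n * z.
Proof.
split=> [xy|[z ->]]; last first.
  by rewrite residue_add residue_mul -natrX residue_nat modnn mul0n mod0n addn0 residue_mod.
have /residue_eq0P[z hz] : residue (x - y) n = 0%N.
  have := residue_add (x - y) y n; rewrite subrK xy => /esym h.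
  have : (residue (x - y)%R n + residue y n = 0 + residue y n %[mod p ^ n])%N.
    by rewrite h add0n residue_mod.
  by move/eqP; rewrite eqn_modDr mod0n residue_mod => /eqP.
by exists z; rewrite -hz addrC subrK.
Qed.

(* On p Z_p the right-hand side is a contraction of ratio 1 / p. *)
Lemma padic_fixpoint a b c : exists z, z = p%:R * a + p%:R * c * z + b * z ^+ 2.
Proof.
pose phi z := p%:R * a + p%:R * c * z + b * z ^+ 2.
have phiB x y : phi x - phi y = (x - y) * (p%:R * c + b * (x + y)) by rewrite /phi; ring.
pose s n := iter n phi 0.
have s_dvd n : exists w, s n = p%:R * w.
  elim: n => [|n [w IH]]; first by exists 0; rewrite mulr0.
  by exists (a + c * (p%:R * w) + b * w * (p%:R * w)); rewrite /s iterS -/(s n) IH /phi; ring.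
have sS n : exists w, s n.+1 = s n + p%:R ^+ n * w.
  elim: n => [|n [w IH]]; first by exists (s 1%N - s 0%N); rewrite expr0; ring.
  have [[w1 h1] [w2 h2]] := (s_dvd n, s_dvd n.+1).
  exists (w * (c + b * (w1 + w2))).
  have -> : s n.+2 = s n.+1 + (phi (s n.+1) - phi (s n)).
    by rewrite -[phi (s n)]/(s n.+1) addrC subrK.
  have -> : phi (s n.+1) - phi (s n) = p%:R ^+ n * w * (p%:R * (c + b * (w1 + w2))).
    have -> : p%:R ^+ n * w = s n.+1 - s n by rewrite IH addrC addKr.
    by rewrite phiB h1 h2; ring.
  by rewrite exprS; ring.
have compat n : (residue (s n.+1) n.+1 = residue (s n) n %[mod p ^ n])%N.
  by rewrite residueS_mod; congr (_ %% _)%N; apply/residue_eqP.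
(* The limit of the iterates: its residue at level n is that of [s n], since later iterates agree
   with [s n] modulo p^n. *)
pose z := padic_of hp compat; exists z; apply: padic_int_ext => n; rewrite -/(phi z).
have zn : residue z n = residue (s n) n by rewrite /= residue_mod.
have /residue_eqP[w hw] := zn.
rewrite zn; have /residue_eqP <- := sS n; rewrite [s n.+1]/(phi (s n)).
apply/esym/residue_eqP; exists (w * (p%:R * c + b * (z + s n))).
apply/eqP; rewrite addrC -subr_eq phiB {1}hw; apply/eqP; ring.
Qed.

End PadicIntegers.

(** * The embedding of Z_p in Q_p, descent and square classes *)

Definition to_padic (p : nat) (hp : prime p) (x : padic_int hp) : padic hp := tofrac x.

HB.instance Definition _ p (hp : prime p) := GRing.isZmodMorphism.Build
  (padic_int hp) (padic hp) (@to_padic p hp) (@tofrac_is_zmod_morphism (padic_int hp)).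
HB.instance Definition _ p (hp : prime p) := GRing.isMonoidMorphism.Build
  (padic_int hp) (padic hp) (@to_padic p hp) (@tofrac_is_monoid_morphism (padic_int hp)).

Local Notation "x %:Qp" := (to_padic x) (at level 2, format "x %:Qp").

Section PadicNumbers.
Variables (p : nat) (hp : prime p).
Implicit Types (x y z u : padic_int hp) (a b : padic hp).

Let q : padic_int hp := p%:R.

Lemma to_padic_eq0 x : (x%:Qp == 0) = (x == 0).
Proof. exact: tofrac_eq0. Qed.

Lemma padic_denominator a : exists d n, d != 0 /\ a * d%:Qp = n%:Qp.
Proof. exact: fraction_denominator. Qed.

Lemma padic_int_natr_inj : injective (fun n : nat => n%:R : padic_int hp).
Proof.
(* Both numbers lie below p^(m + n), so at this level they are their own residues. *)
move=> m n /(congr1 (fun x => residue x (m + n))); rewrite !residue_nat.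
by rewrite !modn_small // (leq_trans (ltn_expl _ (prime_gt1 hp))) //
  leq_exp2l ?prime_gt1 ?leq_addl ?leq_addr.
Qed.

Lemma padic_natr_inj : injective (fun n : nat => n%:R : padic hp).
Proof.
move=> m n; rewrite -!(rmorph_nat (@to_padic p hp)) => /eqP.
by rewrite -subr_eq0 -rmorphB to_padic_eq0 subr_eq0 => /eqP/padic_int_natr_inj.
Qed.

(** Each step extracts a factor p from all three coordinates, so they vanish modulo every power of
    p. *)
Lemma padic_descent (P : padic_int hp -> padic_int hp -> padic_int hp -> Prop) :
  (forall x y z, P x y z -> exists x' y' z',
     [/\ x = q * x', y = q * y', z = q * z' & P x' y' z']) ->
  forall x y z, P x y z -> [/\ x = 0, y = 0 & z = 0].
Proof.
move=> hP; suff h n : forall x y z, P x y z ->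
    [/\ residue x n = 0, residue y n = 0 & residue z n = 0]%N.
  by move=> x y z xyz; split; apply: padic_int_ext => n; have [] := h n _ _ _ xyz;
    rewrite /= mod0n.
elim: n => [|n IH] x y z; first by split; rewrite -residue_mod expn0 modn1.
case/hP => x' [y' [z' [-> -> -> /IH[]]]].
do 3! [move/residue_eq0P => [? ->]].
by split; apply/residue_eq0P; rewrite mulrA -exprS; eexists.
Qed.

Lemma padic_common_denominator a b c : exists d x y z,
  [/\ d != 0, a * d%:Qp = x%:Qp, b * d%:Qp = y%:Qp & c * d%:Qp = z%:Qp].
Proof.
have [[d1 [x [d1n e1]]] [d2 [y [d2n e2]]]] := (padic_denominator a, padic_denominator b).
have [d3 [z [d3n e3]]] := padic_denominator c.
exists (d1 * d2 * d3), (x * d2 * d3), (y * d1 * d3), (z * d1 * d2).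
by split; rewrite ?mulf_neq0 // !rmorphM /= -?e1 -?e2 -?e3; ring.
Qed.

(** Factors p are extracted while the first residue vanishes; the level of a nonvanishing residue
    bounds the number of steps. *)
Lemma padic_int_factor x : x != 0 -> exists n u, x = q ^+ n * u /\ residue u 1 != 0%N.
Proof.
case/padic_neq0 => m /(_ 0%N); rewrite addn0 => hm.
have {hm} : residue x m != 0%N by apply: contraNneq hm => ->.
elim: m x => [|m IH] x hx; first by rewrite -residue_mod expn0 modn1 in hx.
have [/residue_eq0P[y ey]|x1] := eqVneq (residue x 1) 0%N; last first.
  by exists 0%N, x; rewrite mul1r.
have [|n [u [eu u1]]] := IH y; last by exists n.+1, u; rewrite ey eu expr1 exprS mulrA.
apply: contraNneq hx => /residue_eq0P[z ez].
by apply/eqP/residue_eq0P; exists z; rewrite ey ez expr1 exprS mulrA.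
Qed.

(** Writing a = n / d = n d / d^2 reduces to the integer n d. The even part of its valuation goes
    into the square, and [b] is the parity of the valuation. *)
Lemma padic_square_class a : a != 0 -> exists s u (b : bool),
  residue u 1 != 0%N /\ a = s ^+ 2 * (q ^+ b * u)%:Qp.
Proof.
move=> a0; have [d [n [dn e]]] := padic_denominator a.
have Fd0 : d%:Qp != 0 by rewrite to_padic_eq0.
have nd0 : n * d != 0.
  by rewrite mulf_neq0 // -to_padic_eq0 -e mulf_neq0.
have [m [u [em u1]]] := padic_int_factor nd0.
exists ((q ^+ m./2)%:Qp / d%:Qp), u, (odd m); split=> //.
have -> : a = (n * d)%:Qp / d%:Qp ^+ 2.
  have -> : (n * d)%:Qp = a * d%:Qp * d%:Qp by rewrite e -rmorphM.
  by rewrite expr2 invfM mulrA !mulfK.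
rewrite em -{1}(odd_double_half m) exprD -mul2n mulnC exprM.
have -> : (q ^+ odd m * q ^+ m./2 ^+ 2 * u)%:Qp = (q ^+ m./2)%:Qp ^+ 2 * (q ^+ odd m * u)%:Qp.
  by rewrite mulrAC mulrC rmorphM rmorphXn.
by rewrite expr_div_n mulrAC.
Qed.

End PadicNumbers.

Lemma square_class_twist (F : fieldType) (t u v w : F) : w != 0 -> u * w = v ^+ 2 ->
  t * u = (v / w) ^+ 2 * (t * w).
Proof. by move=> w0 uw; rewrite expr_div_n -uw; field. Qed.

(** * Odd primes *)

Lemma neq_eqF (T : eqType) (x y : T) : x != y -> ((x == y) = false) * ((y == x) = false).
Proof. by move=> /negPf xy; rewrite [y == x]eq_sym xy. Qed.

(* If the square class of y only carries the twists 1 and tw y, it suffices that neither tw y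
   nor - tw y is a norm: 1 / tw y and tw y lie in the same coset. *)
Lemma twist_pair_norm (K : fieldType) (tw : K -> K) (L : seq (K * K)) :
  (forall y t, (y, t) \in L -> t = 1 \/ t = tw y) ->
  (forall y t u v, (y, t) \in L -> tw y != 1 -> (u ^+ 2 + y * v ^+ 2) ^+ 2 != tw y ^+ 2) ->
  forall y t t' u v, (y, t) \in L -> (y, t') \in L ->
  t' ^+ 2 = (u ^+ 2 + y * v ^+ 2) ^+ 2 * t ^+ 2 -> t' = t.
Proof.
move=> twL twN y t t' u v h h'.
have [tw1|tw1] := eqVneq (tw y) 1.
  by case: (twL _ _ h) (twL _ _ h') => -> [] ->; rewrite ?tw1.
case: (twL _ _ h) (twL _ _ h') => -> [] -> // e.
  by case/eqP: (twN _ _ u v h tw1); rewrite e; ring.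
case/eqP: (twN _ _ (tw y * u) (tw y * v) h tw1).
have -> : ((tw y * u) ^+ 2 + y * (tw y * v) ^+ 2) ^+ 2 =
  (u ^+ 2 + y * v ^+ 2) ^+ 2 * tw y ^+ 2 * tw y ^+ 2 by ring.
by rewrite -e; ring.
Qed.

(** * Square classes and twists for odd p *)

Section OddReps.
Variables (K : fieldType) (e q : K).
Hypothesis char0 : injective (fun n : nat => n%:R : K).
Hypothesis total : forall a, a != 0 ->
  exists2 y, y \in [:: 1; e; q; e * q] & exists s, a = s ^+ 2 * y.
(** In the application e is a nonsquare unit and q is p. All nonsquare and non-norm statements of
    the section are instances of this anisotropy, with one coordinate set to 0 or with a coordinate
    fixed to a nonzero value. *)
Hypothesis aniso : forall t x y z, t \in [:: 1; -1; e; -e] ->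
  x ^+ 2 - e * y ^+ 2 + q * t * z ^+ 2 = 0 -> [/\ x = 0, y = 0 & z = 0].

Let isotropic t x y z : t \in [:: 1; -1; e; -e] ->
  x ^+ 2 - e * y ^+ 2 + q * t * z ^+ 2 = 0 -> [|| x != 0, y != 0 | z != 0] -> False.
Proof. by move=> tt /(aniso tt)[-> -> ->]; rewrite eqxx. Qed.

Let e_nonsquare x y : x ^+ 2 = e * y ^+ 2 -> (x != 0) || (y != 0) -> False.
Proof.
move=> h xy; apply: (isotropic (t := 1) (x := x) (y := y) (z := 0)); rewrite ?inE ?eqxx //.
- by rewrite h; ring.
- by rewrite orbF.
Qed.

Let q_nonsquare x y : x ^+ 2 = q * y ^+ 2 -> (x != 0) || (y != 0) -> False.
Proof.
move=> h xy; apply: (isotropic (t := -1) (x := x) (y := 0) (z := y)); rewrite ?inE ?eqxx ?orbT //.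
by rewrite h; ring.
Qed.

Let eq_nonsquare x y : x ^+ 2 = e * q * y ^+ 2 -> (x != 0) || (y != 0) -> False.
Proof.
move=> h xy; apply: (isotropic (t := -e) (x := x) (y := 0) (z := y)); rewrite ?inE ?eqxx ?orbT //.
by rewrite h; ring.
Qed.

Let e0 : e != 0.
Proof.
apply/eqP => e0; apply: (@e_nonsquare 0 1); last by rewrite oner_eq0 orbT.
by rewrite e0; ring.
Qed.

Let q0 : q != 0.
Proof.
apply/eqP => q0; apply: (@q_nonsquare 0 1); last by rewrite oner_eq0 orbT.
by rewrite q0; ring.
Qed.

(** Each relation between two different representatives makes e, q or e q a square, after
    multiplication by a suitable square. *)
Lemma odd_reps_square y y' s : y \in [:: 1; e; q; e * q] -> y' \in [:: 1; e; q; e * q] ->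
  y' = s ^+ 2 * y -> y' = y.
Proof.
have one0 := oner_neq0 K.
rewrite !inE => /or4P[] /eqP -> /or4P[] /eqP -> // h; exfalso.
- by apply: (@e_nonsquare s 1); rewrite ?one0 ?orbT // h; ring.
- by apply: (@q_nonsquare s 1); rewrite ?one0 ?orbT // h; ring.
- by apply: (@eq_nonsquare s 1); rewrite ?one0 ?orbT // h; ring.
- by apply: (@e_nonsquare 1 s); rewrite ?one0 // mulrC -h expr1n.
- by apply: (@eq_nonsquare (e * s) 1); rewrite ?one0 ?orbT // h; ring.
- apply: (@q_nonsquare (e * s) e); rewrite ?e0 ?orbT //.
  have -> : (e * s) ^+ 2 = e * (s ^+ 2 * e) by ring.
  by rewrite -h; ring.
- by apply: (@q_nonsquare 1 s); rewrite ?one0 // mulrC -h expr1n.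
- by apply: (@eq_nonsquare (q * s) 1); rewrite ?one0 ?orbT // h; ring.
- apply: (@e_nonsquare (q * s) q); rewrite ?q0 ?orbT //.
  have -> : (q * s) ^+ 2 = q * (s ^+ 2 * q) by ring.
  by rewrite -h; ring.
- by apply: (@eq_nonsquare 1 s); rewrite ?one0 // mulrC -h expr1n.
- apply: (@q_nonsquare e (e * s)); rewrite ?e0 //.
  by rewrite expr2 {2}h; ring.
- apply: (@e_nonsquare q (q * s)); rewrite ?q0 //.
  by rewrite expr2 {2}h; ring.
Qed.

Lemma odd_reps_uniq : uniq [:: 1; e; q; e * q].
Proof.
have one0 := oner_neq0 K.
rewrite /= !inE !negb_or -!andbA !andbT.
apply/and5P; split; last (apply/andP; split); apply/eqP => h.
- by apply: (@e_nonsquare 1 1); rewrite ?one0 // -h; ring.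
- by apply: (@q_nonsquare 1 1); rewrite ?one0 // -h; ring.
- by apply: (@eq_nonsquare 1 1); rewrite ?one0 // -h; ring.
- by apply: (@eq_nonsquare e 1); rewrite ?one0 ?orbT // -h; ring.
- by apply: (@q_nonsquare e e); rewrite ?e0 // expr2 {2}h; ring.
- by apply: (@e_nonsquare q q); rewrite ?q0 // expr2 {2}h; ring.
Qed.

Lemma odd_reps_neq0 : 0 \notin [:: 1; e; q; e * q].
Proof.
by rewrite !inE !negb_or ![0 == _]eq_sym mulf_neq0 ?oner_neq0 ?e0 ?q0.
Qed.

(** As -1 is a square, a change of sign never changes the norm coset. The form u^2 + v^2 represents
    everything, and each of the three other classes needs a second twist: q for e, and e for q and e
    q. *)
Lemma odd_norm_reps1 (i : K) : i ^+ 2 = -1 -> norm_reps [:: 1; e; q; e * q]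
  [:: (1, 1); (e, 1); (q, 1); (e * q, 1); (q, e); (e * q, e); (e, q)].
Proof.
move=> ii; have one0 := oner_neq0 K.
have := odd_reps_uniq.
rewrite /= !inE !negb_or -!andbA => /and5P[ne1 nq1 neq1 neq /and3P[nee nqq _]].
pose neqY := (neq_eqF ne1, neq_eqF nq1, neq_eqF neq1, neq_eqF neq, neq_eqF nee, neq_eqF nqq).
split=> //.
- exact: odd_reps_uniq.
- exact: odd_reps_neq0.
- exact: odd_reps_square.
- by rewrite /= !inE !xpair_eqE !neqY !eqxx.
- move=> y t; rewrite !inE !xpair_eqE.
  by do 6? [case/orP]; case/andP => /eqP -> /eqP ->; rewrite ?eqxx ?orbT ?one0 ?e0 ?q0.
- have two0 : 2 != 0 :> K by apply/eqP => /(@char0 2 0).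
  move=> y a yY aY; have {yY} : y \in [:: 1; e; q; e * q] by [].
  have {aY} : a \in [:: 1; e; q; e * q] by [].
  rewrite !inE => aY /or4P[] /eqP ->.
  (* Since i^2 = -1, this is a difference of two squares equal to a. *)
  + exists 1, ((a + 1) / 2), (i * (a - 1) / 2); split; first by rewrite !inE eqxx.
    have -> : (i * (a - 1) / 2) ^+ 2 = i ^+ 2 * ((a - 1) / 2) ^+ 2 by ring.
    by rewrite ii; field.
  + case/or4P: aY => /eqP ->.
    * by exists 1, 1, 0; split; [rewrite !inE !eqxx ?orbT|ring].
    * by exists 1, 0, 1; split; [rewrite !inE !eqxx ?orbT|ring].
    * by exists q, q, 0; split; [rewrite !inE !eqxx ?orbT|ring].
    * by exists q, 0, q; split; [rewrite !inE !eqxx ?orbT|ring].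
  + case/or4P: aY => /eqP ->.
    * by exists 1, 1, 0; split; [rewrite !inE !eqxx ?orbT|ring].
    * by exists e, e, 0; split; [rewrite !inE !eqxx ?orbT|ring].
    * by exists 1, 0, 1; split; [rewrite !inE !eqxx ?orbT|ring].
    * by exists e, 0, e; split; [rewrite !inE !eqxx ?orbT|ring].
  + case/or4P: aY => /eqP ->.
    * by exists 1, 1, 0; split; [rewrite !inE !eqxx ?orbT|ring].
    * by exists e, e, 0; split; [rewrite !inE !eqxx ?orbT|ring].
    * by exists e, 0, 1; split; [rewrite !inE !eqxx ?orbT|ring].
    * by exists 1, 0, 1; split; [rewrite !inE !eqxx ?orbT|ring].
apply: (@twist_pair_norm _ (fun y => if y == 1 then 1 else if y == e then q else e)).
- move=> y t; rewrite !inE !xpair_eqE.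
  do 6? [case/orP]; case/andP => /eqP -> /eqP ->; try (by left);
  rewrite ?eqxx ?neqY; by right.
move=> y t u v h.
have {h} : y \in [:: 1; e; q; e * q].
  by move: h; rewrite !inE !xpair_eqE; do 6? [case/orP]; case/andP => -> _; rewrite ?orbT.
(* A norm equal to plus or minus the twist yields a zero of a form in [aniso]. It is nontrivial
   since the twist q comes with z' = 1, and the twists e and -e with y' = 1 and y' = i. *)
have isoN t' x y' z' : t' \in [:: 1; -1; e; -e] ->
    x ^+ 2 - e * y' ^+ 2 + q * t' * z' ^+ 2 = 0 -> y' ^+ 2 = -1 \/ y' = 1 \/ z' = 1 -> False.
  move=> ht' hx [hy|[hy|hz]]; apply: (isotropic ht' hx); rewrite ?hy ?hz ?one0 ?orbT //.
  by rewrite -(sqrf_eq0 y') hy oppr_eq0 one0 orbT.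
rewrite !inE => /or4P[] /eqP ->;
  rewrite ?eqxx ?neqY ?eqxx // => _;
  rewrite eqf_sqr; apply/negP => /orP[] /eqP h.
- apply: (isoN (-1) u (i * v) 1); rewrite ?inE ?eqxx ?orbT //; last by do 2! right.
  by rewrite exprMn ii mulN1r mulrN opprK h; ring.
- apply: (isoN 1 u (i * v) 1); rewrite ?inE ?eqxx ?orbT //; last by do 2! right.
  by rewrite exprMn ii mulN1r mulrN opprK h; ring.
- apply: (isoN 1 u 1 v); rewrite ?inE ?eqxx ?orbT //; last by right; left.
  by rewrite mulr1 addrAC h; ring.
- apply: (isoN 1 u i v); rewrite ?inE ?eqxx ?orbT //; last by left.
  by rewrite mulr1 addrAC h ii; ring.
- apply: (isoN e u 1 v); rewrite ?inE ?eqxx ?orbT //; last by right; left.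
  by rewrite [q * e]mulrC addrAC h; ring.
- apply: (isoN e u i v); rewrite ?inE ?eqxx ?orbT //; last by left.
  by rewrite [q * e]mulrC addrAC h ii; ring.
Qed.

(** Now -1 is a nonsquare. For y = q and y = -q the sign allowed by the squared condition already
    covers every [a], and u^2 - v^2 represents everything; only y = 1 needs the second twist q. *)
Lemma odd_norm_reps3 : e = -1 ->
  norm_reps [:: 1; -1; q; -q] [:: (1, 1); (-1, 1); (q, 1); (-q, 1); (1, q)].
Proof.
move=> eN1; have one0 := oner_neq0 K.
have YE : [:: 1; -1; q; -q] = [:: 1; e; q; e * q] by rewrite eN1 mulN1r.
have := odd_reps_uniq; rewrite -YE => uY.
have := uY.
rewrite /= !inE !negb_or -!andbA => /and5P[ne1 nq1 neq1 neq /and3P[nee nqq _]].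
pose neqY := (neq_eqF ne1, neq_eqF nq1, neq_eqF neq1, neq_eqF neq, neq_eqF nee, neq_eqF nqq).
split=> //.
- by rewrite YE odd_reps_neq0.
- by rewrite YE.
- by rewrite YE; exact: odd_reps_square.
- by rewrite /= !inE !xpair_eqE !neqY !eqxx.
- move=> y t; rewrite !inE !xpair_eqE.
  by do 4? [case/orP]; case/andP => /eqP -> /eqP ->; rewrite ?eqxx ?orbT ?one0 ?q0.
- have two0 : 2 != 0 :> K by apply/eqP => /(@char0 2 0).
  move=> y a; rewrite !inE => /or4P[] /eqP -> aY.
  + case/or4P: aY => /eqP ->.
    * by exists 1, 1, 0; split; [rewrite !inE !eqxx ?orbT|ring].
    * by exists 1, 1, 0; split; [rewrite !inE !eqxx ?orbT|ring].
    * by exists q, q, 0; split; [rewrite !inE !eqxx ?orbT|ring].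
    * by exists q, q, 0; split; [rewrite !inE !eqxx ?orbT|ring].
  + exists 1, ((a + 1) / 2), ((a - 1) / 2); split; first by rewrite !inE eqxx ?orbT.
    by field.
  + case/or4P: aY => /eqP ->.
    * by exists 1, 1, 0; split; [rewrite !inE !eqxx ?orbT|ring].
    * by exists 1, 1, 0; split; [rewrite !inE !eqxx ?orbT|ring].
    * by exists 1, 0, 1; split; [rewrite !inE !eqxx ?orbT|ring].
    * by exists 1, 0, 1; split; [rewrite !inE !eqxx ?orbT|ring].
  + case/or4P: aY => /eqP ->.
    * by exists 1, 1, 0; split; [rewrite !inE !eqxx ?orbT|ring].
    * by exists 1, 1, 0; split; [rewrite !inE !eqxx ?orbT|ring].
    * by exists 1, 0, 1; split; [rewrite !inE !eqxx ?orbT|ring].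
    * by exists 1, 0, 1; split; [rewrite !inE !eqxx ?orbT|ring].
apply: (@twist_pair_norm _ (fun y => if y == 1 then q else 1)).
- move=> y t; rewrite !inE !xpair_eqE.
  do 4? [case/orP]; case/andP => /eqP -> /eqP ->; try (by left).
  by right; rewrite eqxx.
move=> y t u v _; have [->|_] := eqVneq y 1; last by rewrite eqxx.
move=> _.
rewrite eqf_sqr mul1r; apply/negP => /orP[] /eqP h.
- apply: (@isotropic (-1) u v 1); rewrite ?inE ?eqxx ?one0 ?orbT //.
  by rewrite eN1 mulN1r opprK h; ring.
- apply: (@isotropic 1 u v 1); rewrite ?inE ?eqxx ?one0 ?orbT //.
  by rewrite eN1 mulN1r opprK h; ring.
Qed.

End OddReps.

(** * Squares in finite fields *)

Lemma field_unit_generator (F : finFieldType) : exists g : {unit F},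
  #[g]%g = #|F|.-1 /\ forall c : F, c != 0 -> exists n, c = FinRing.uval g ^+ n.
Proof.
have /cyclicP[g hg] := field_unit_group_cyclic [set: {unit F}]%G.
exists g; split; first by rewrite -card_finField_unit /order -hg.
move=> c c0; have uc : c \is a GRing.unit by rewrite unitfE.
have : FinRing.unit F uc \in <[g]>%g by rewrite -hg inE.
by case/cycleP => n /(congr1 FinRing.uval); rewrite FinRing.val_unitX; exists n.
Qed.

(** Nonsquares are odd powers of a generator, so the exponents add up to an even number. *)
Lemma mul_nonsquares (F : finFieldType) (a b : F) :
  (forall x, a != x ^+ 2) -> (forall x, b != x ^+ 2) -> exists x, a * b = x ^+ 2.
Proof.
move=> na nb; have neq0 c : (forall x : F, c != x ^+ 2) -> c != 0.
  by move=> /(_ 0); rewrite expr0n.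
have [g [_ powg]] := field_unit_generator F.
have [[m hm] [n hn]] := (powg _ (neq0 _ na), powg _ (neq0 _ nb)).
have oddP c k : (forall x, c != x ^+ 2) -> c = FinRing.uval g ^+ k -> odd k.
  move=> nc ck; apply: contraT => /even_halfK kE; case/eqP: (nc (FinRing.uval g ^+ k./2)).
  by rewrite -exprM muln2 kE.
exists (FinRing.uval g ^+ (m + n)./2); rewrite -exprM muln2 even_halfK ?exprD -?hm -?hn //.
by rewrite oddD (oddP a m) // (oddP b n).
Qed.

(** If -1 = g^n, then p - 1 divides 2n; as 4 divides p - 1, n is even and g^(n/2) is a root. *)
Lemma Fp_sqrtN1 p : prime p -> (p %% 4 = 1)%N -> exists x : 'F_p, x ^+ 2 = -1.
Proof.
move=> hp p1; have [g [og powg]] := field_unit_generator 'F_p.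
have [n hn] : exists n, -1 = FinRing.uval g ^+ n by apply: powg; rewrite oppr_eq0 oner_neq0.
have : (g ^+ (n * 2) = 1)%g.
  by apply/val_inj; rewrite /= FinRing.val_unitX exprM -hn sqrrN expr1n.
move/eqP; rewrite -order_dvdn og card_Fp // => dn.
have ev : ~~ odd n.
  have : (2 * 2 %| n * 2)%N.
    apply: dvdn_trans dn.
    have -> : p.-1 = (p %/ 4 * 4)%N by rewrite {1}(divn_eq p 4) p1 addn1.
    exact: dvdn_mull.
  by rewrite dvdn_pmul2r // dvdn2.
by exists (FinRing.uval g ^+ n./2); rewrite -exprM muln2 even_halfK.
Qed.

(** If x^2 = -1, then x^4 = 1 and Fermat gives x = x^p = x^3 = -x, hence 2x = 0. *)
Lemma Fp_nonsquareN1 p : prime p -> (p %% 4 = 3)%N -> forall x : 'F_p, -1 != x ^+ 2.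
Proof.
move=> hp p3 x; apply/eqP => hx.
have := expf_card x; rewrite card_Fp //.
have -> : x ^+ p = x ^+ (4 * (p %/ 4) + 3).
  by congr (_ ^+ _); rewrite {1}(divn_eq p 4) p3 mulnC.
rewrite exprD exprM.
rewrite (_ : x ^+ 4 = 1) ?expr1n ?mul1r; last by rewrite (exprM x 2 2) -hx sqrrN expr1n.
rewrite (exprD x 2 1) -hx mulN1r expr1 => /eqP.
rewrite eq_sym -addr_eq0 -mulr2n -mulr_natl mulf_eq0 => /orP[|/eqP x0].
  rewrite -(dvdn_pcharf (pchar_Fp hp)) => /(dvdn_leq (isT : 0 < 2)%N) p2.
  by move: p3 (p2); rewrite modn_small ?(leq_ltn_trans p2) // => ->.
by move/eqP: hx; rewrite x0 expr0n oppr_eq0 oner_eq0.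
Qed.

(** * Reduction modulo p, square roots of units and anisotropic forms *)

Section Reduction.
Variables (p : nat) (hp : prime p).
Implicit Types x y z u : padic_int hp.
Let q : padic_int hp := p%:R.

Definition reduction x : 'F_p := (residue x 1)%:R.

Lemma reductionD x y : reduction (x + y) = reduction x + reduction y.
Proof. by rewrite /reduction residue_add expn1 Fp_nat_mod // natrD. Qed.

Lemma reductionM x y : reduction (x * y) = reduction x * reduction y.
Proof. by rewrite /reduction residue_mul expn1 Fp_nat_mod // natrM. Qed.

Lemma reductionX x n : reduction (x ^+ n.+1) = reduction x ^+ n.+1.
Proof. by elim: n => [|n IH]; rewrite ?expr1 // ![_ ^+ n.+2]exprS reductionM IH. Qed.

Lemma reduction_nat n : reduction n%:R = n%:R.
Proof. by rewrite /reduction residue_nat expn1 Fp_nat_mod. Qed.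

Lemma reductionN x : reduction (- x) = - reduction x.
Proof. by apply/eqP; rewrite -addr_eq0 -reductionD addNr (reduction_nat 0). Qed.

Lemma reduction_eqP x y : reduction x = reduction y <-> exists z, x = y + q * z.
Proof.
split=> [|[z ->]]; last by rewrite reductionD reductionM reduction_nat pchar_Fp_0 // mul0r addr0.
move=> /(congr1 val); rewrite /= !val_Fp_nat // => h.
have /residue_eqP[z hz] : residue x 1 = residue y 1.
  by rewrite -[LHS]residue_mod -[RHS]residue_mod !expn1.
by exists z; rewrite hz expr1.
Qed.

Lemma reduction_eq0P x : reduction x = 0 <-> exists z, x = q * z.
Proof.
have := reduction_eqP x 0; rewrite (reduction_nat 0) => ->.
by split=> -[z ->]; exists z; rewrite add0r.
Qed.

Lemma reduction_neq0 u : (reduction u != 0) = (residue u 1 != 0%N).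
Proof.
congr (~~ _); apply/eqP/eqP => [/reduction_eq0P[z ->]|u0].
  by apply/residue_eq0P; exists z.
by rewrite /reduction u0.
Qed.

Hypothesis p_odd : odd p.

(** Multiplying (1 + z)^2 = 1 + p m by h = (p + 1) / 2 turns the linear term into z + p z, which
    gives the fixed point equation z = p h m - p z - h z^2. *)
Lemma padic_int_sqrt m : exists z, 1 + q * m = z ^+ 2.
Proof.
pose h : padic_int hp := (p.+1)./2%:R.
have h2 : 2 * h = q + 1 by rewrite -natrM mul2n even_halfK //= ?p_odd // -addn1 natrD.
have h0 : h != 0.
  by apply/eqP => /(@padic_int_natr_inj _ hp _ 0)/eqP; case: (p) (prime_gt1 hp) => [|[]].
have [z hz] := padic_fixpoint (h * m) (-h) (-1).
exists (1 + z); apply: (mulfI h0).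
have e : z + q * z + h * z ^+ 2 = q * (h * m) by rewrite {1}hz /q; ring.
have -> : h * (1 + z) ^+ 2 = h + (2 * h) * z + h * z ^+ 2 by ring.
by rewrite h2 mulrDl mul1r [q * z + z]addrC -!addrA addrA -addrA [z + _]addrA e; ring.
Qed.

(** With [w] an integer lift of 1/t, u w^2 is 1 modulo p and has a root by [padic_int_sqrt]. *)
Lemma padic_sqrt u (t : 'F_p) : residue u 1 != 0%N -> reduction u = t ^+ 2 ->
  exists s : padic hp, u%:Qp = s ^+ 2.
Proof.
move=> u1 ut; have t0 : t != 0 by rewrite -sqrf_eq0 -ut reduction_neq0.
pose w := val t^-1.
have wt : w%:R = t^-1 :> 'F_p by rewrite natr_Zp.
have w0 : (w%:R : padic_int hp)%:Qp != 0.
  rewrite to_padic_eq0; apply/eqP => /(@padic_int_natr_inj _ hp _ 0) w0.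
  by case/eqP: (invr_neq0 t0); rewrite -wt w0.
have /reduction_eqP[m hm] : reduction (u * w%:R ^+ 2) = reduction 1%:R.
  by rewrite reductionM reductionX !reduction_nat ut wt -exprMn mulfV // expr1n.
have [z hz] := padic_int_sqrt m.
exists (z%:Qp / w%:R%:Qp).
by rewrite expr_div_n -rmorphXn -hz -hm rmorphM rmorphXn mulfK ?expf_neq0.
Qed.

Lemma padic_anisotropic (a b c : padic_int hp) :
  (forall x y z, a * x ^+ 2 + b * y ^+ 2 + c * z ^+ 2 = 0 -> [/\ x = 0, y = 0 & z = 0]) ->
  forall x y z : padic hp,
  a%:Qp * x ^+ 2 + b%:Qp * y ^+ 2 + c%:Qp * z ^+ 2 = 0 -> [/\ x = 0, y = 0 & z = 0].
Proof.
move=> h x y z e; have [d [x1 [y1 [z1 [d0 ex ey ez]]]]] := padic_common_denominator x y z.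
have Fd0 : d%:Qp != 0 by rewrite to_padic_eq0.
have [] := h x1 y1 z1.
  apply/eqP; rewrite -to_padic_eq0 !rmorphD /= (rmorphM _ a) (rmorphM _ b) (rmorphM _ c) /=.
  rewrite !rmorphXn /= -ex -ey -ez.
  set A := a%:Qp; set B := b%:Qp; set C := c%:Qp; set D := d%:Qp.
  have -> : A * (x * D) ^+ 2 + B * (y * D) ^+ 2 + C * (z * D) ^+ 2 =
    (A * x ^+ 2 + B * y ^+ 2 + C * z ^+ 2) * D ^+ 2 by ring.
  by rewrite e mul0r.
move=> x0 y0 z0; rewrite x0 y0 z0 !rmorph0 in ex ey ez.
by split; apply: (mulIf Fd0); rewrite mul0r.
Qed.

Section Nonsquare.
Variable e : padic_int hp.
Hypothesis e_nonsquare : forall t, reduction e != t ^+ 2.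

(** Either the unit part u or, by [mul_nonsquares], the product u e is a square modulo p, and hence
    a square in Q_p. *)
Lemma padic_nonsquare_total (a : padic hp) : a != 0 ->
  exists2 y, y \in [:: 1; e%:Qp; p%:R; e%:Qp * p%:R] & exists s, a = s ^+ 2 * y.
Proof.
have e0 : e%:Qp != 0.
  rewrite to_padic_eq0; apply: contraNneq (e_nonsquare 0) => ->.
  by rewrite (reduction_nat 0) expr0n.
case/padic_square_class => s [u [b [u1 ->]]].
rewrite rmorphM rmorphXn rmorph_nat /=.
have [[t ht]|nt] := pselect (exists t, reduction u = t ^+ 2).
  have [w hw] := padic_sqrt u1 ht; exists (p%:R ^+ b).
    by case: b; rewrite !inE ?expr1 ?expr0 eqxx ?orbT.
  by exists (s * w); rewrite hw exprMn mulrCA [LHS]mulrC.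
have [t ht] : exists t, reduction u * reduction e = t ^+ 2.
  by apply: mul_nonsquares => // x; apply/eqP => hx; apply: nt; exists x.
have ue1 : residue (u * e) 1 != 0%N.
  rewrite -reduction_neq0 reductionM mulf_neq0 ?reduction_neq0 //.
  by rewrite -reduction_neq0; apply: contraNneq (e_nonsquare 0) => ->; rewrite expr0n.
have [w hw] : exists w : padic hp, (u * e)%:Qp = w ^+ 2.
  by apply: (padic_sqrt (t := t)); rewrite ?reductionM.
exists (e%:Qp * p%:R ^+ b).
  by case: b; rewrite !inE ?expr1 ?expr0 ?mulr1 eqxx ?orbT.
exists (s * (w / e%:Qp)).
rewrite exprMn -[RHS]mulrA; congr (_ * _); rewrite [e%:Qp * _]mulrC.
by apply: square_class_twist => //; rewrite -hw rmorphM.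
Qed.

(** Modulo p the equation reads x^2 = e y^2, so p divides x and y. Dividing the equation by p then
    leaves t z^2 = 0 modulo p, and the descent goes on. *)
Lemma padic_nonsquare_aniso (t : padic_int hp) (x y z : padic hp) : reduction t != 0 ->
  x ^+ 2 - e%:Qp * y ^+ 2 + p%:R * t%:Qp * z ^+ 2 = 0 -> [/\ x = 0, y = 0 & z = 0].
Proof.
move=> t0; have := @padic_anisotropic 1 (- e) (q * t).
rewrite rmorph1 rmorphN rmorphM rmorph_nat => h; rewrite -[x ^+ 2]mul1r -mulNr; apply: h => {x y z}.
apply: padic_descent => x y z; rewrite mul1r mulNr => exyz.
have q0 : q != 0.
  by apply/eqP => /(@padic_int_natr_inj _ hp _ 0) p0; have := prime_gt0 hp; rewrite p0.
have /esym : reduction (x ^+ 2 - e * y ^+ 2 + q * t * z ^+ 2) = 0 by rewrite exyz (reduction_nat 0).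
rewrite 2!reductionD reductionN (reductionM e) (reductionM (q * t)) (reductionM q) !reductionX
  reduction_nat pchar_Fp_0 // !mul0r addr0.
move/esym/eqP; rewrite subr_eq0 => /eqP exy.
have y0 : reduction y = 0.
  apply/eqP; apply: contraT => y0; case/eqP: (e_nonsquare (reduction x / reduction y)).
  by rewrite expr_div_n exy mulfK ?expf_neq0.
have x0 : reduction x = 0.
  by apply/eqP; rewrite -sqrf_eq0 exy y0 expr0n mulr0.
move/reduction_eq0P: x0 => [x' ex]; move/reduction_eq0P: y0 => [y' ey].
have ez : q * (x' ^+ 2 - e * y' ^+ 2) + t * z ^+ 2 = 0.
  by apply: (mulfI q0); rewrite mulr0 -exyz ex ey /q; ring.
have /reduction_eq0P[z' ez'] : reduction z = 0.
  have /eqP : reduction (q * (x' ^+ 2 - e * y' ^+ 2) + t * z ^+ 2) = 0.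
    by rewrite ez (reduction_nat 0).
  rewrite reductionD (reductionM q) (reductionM t) reductionX reduction_nat pchar_Fp_0 //.
  by rewrite mul0r add0r mulf_eq0 (negPf t0) sqrf_eq0 => /eqP.
exists x', y', z'; split=> //; rewrite mul1r mulNr; apply: (mulfI q0).
by rewrite mulr0 -ez ez'; ring.
Qed.

End Nonsquare.
End Reduction.

Lemma square_modP p (c : nat) : prime p ->
  reflect (exists x : 'F_p, c%:R = x ^+ 2) (square_mod p c).
Proof.
move=> hp; have modE (a b : nat) : (a == b %[mod p]) = (a%:R == b%:R :> 'F_p).
  by rewrite -val_eqE /= !val_Fp_nat.
apply: (iffP existsP) => [[x]|[x hx]].
  by rewrite modE natrX => /eqP hx; exists x%:R.
have xp : (x < p)%N by rewrite -[X in (_ < X)%N](Fp_cast hp).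
by exists (Ordinal xp); rewrite modE natrX natr_Zp hx.
Qed.

(** The search must succeed: as p - 1 is even, no even power of a generator equals the generator,
    which is therefore a nonresidue. *)
Lemma least_nonresidueP p : prime p -> odd p -> forall x : 'F_p, (least_nonresidue p)%:R != x ^+ 2.
Proof.
move=> hp op x; apply/eqP => hx.
have : has (fun c => ~~ square_mod p c) (iota 0 p).
  have [g [og powg]] := field_unit_generator 'F_p.
  have gp : (FinRing.uval g < p)%N by rewrite -[X in (_ < X)%N](Fp_cast hp).
  apply/hasP; exists (FinRing.uval g : nat); first by rewrite mem_iota.
  apply/square_modP => // -[y]; rewrite natr_Zp => hy.
  have [n hn] : exists n, y = FinRing.uval g ^+ n.
    apply: powg; apply/eqP => y0.
    have := valP g; rewrite /= unitfE hy y0 expr0n eqxx.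
    by [].
  have : (g ^+ (n * 2) == g ^+ 1)%g.
    by apply/eqP/val_inj; rewrite /= FinRing.val_unitX exprM -hn -hy expg1.
  rewrite eq_expg_mod_order og card_Fp // => /eqP /(congr1 odd).
  have op1 : odd p.-1 = false by case: (p) op => //= k /negbTE.
  by rewrite !odd_mod // oddM andbF.
move=> hs; have := nth_find 0%N hs.
rewrite nth_iota ?add0n; last by rewrite -[X in (_ < X)%N](size_iota 0 p) -has_find.
by case/negP; apply/square_modP => //; exists x.
Qed.

Lemma odd_mod4 p k : (p %% 4 = k)%N -> odd p = odd k.
Proof. by move=> <-; rewrite odd_mod. Qed.

Lemma padic_nonsquare_aniso_unit p (hp : prime p) (e : padic_int hp) :
  (forall t, reduction e != t ^+ 2) -> forall t x y z : padic hp,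
  t \in [:: 1; -1; e%:Qp; - e%:Qp] ->
  x ^+ 2 - e%:Qp * y ^+ 2 + p%:R * t * z ^+ 2 = 0 -> [/\ x = 0, y = 0 & z = 0].
Proof.
move=> ns t x y z ht.
have e0 : reduction e != 0 by apply: contraNneq (ns 0) => ->; rewrite expr0n.
have [t' -> t'0] : exists2 t' : padic_int hp, t = t'%:Qp & reduction t' != 0.
  move: ht; rewrite !inE => /or4P[] /eqP ->.
  - by exists 1; rewrite ?rmorph1 // (reduction_nat _ 1) oner_neq0.
  - by exists (-1); rewrite ?rmorphN1 // reductionN oppr_eq0 (reduction_nat _ 1) oner_neq0.
  - by exists e.
  - by exists (- e); rewrite ?rmorphN // reductionN oppr_eq0.
exact: padic_nonsquare_aniso.
Qed.

Lemma padic_classification1 p (hp : prime p) : (p %% 4 = 1)%N ->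
  classification (nonresidue_X (padic hp) p) (1 :: nonresidue_Y (padic hp) p) 7 4.
Proof.
move=> p1; have op : odd p by rewrite (odd_mod4 p1).
pose e : padic_int hp := (least_nonresidue p)%:R.
have ns t : reduction e != t ^+ 2 by rewrite reduction_nat; exact: least_nonresidueP.
have [t ht] := Fp_sqrtN1 hp p1.
have [i hi] : exists i : padic hp, (-1 : padic_int hp)%:Qp = i ^+ 2.
  apply: (padic_sqrt op (t := t)); last by rewrite reductionN (reduction_nat _ 1) ht.
  by rewrite -reduction_neq0 reductionN oppr_eq0 (reduction_nat _ 1) oner_neq0.
rewrite rmorphN1 in hi.
have := odd_norm_reps1 (@padic_natr_inj _ hp) (padic_nonsquare_total op ns)
  (padic_nonsquare_aniso_unit ns) (esym hi).
move=> /norm_reps_classification; rewrite rmorph_nat /nonresidue_X /nonresidue_Y p1 /=.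
set c := (least_nonresidue p)%:R; set r := p%:R.
have c3 : c ^+ 2 * (c * r) = c ^+ 3 * r by rewrite mulrA -exprSr.
by rewrite !expr1n !mul1r c3 [r ^+ 2 * c]mulrC.
Qed.

Lemma padic_classification3 p (hp : prime p) : (p %% 4 = 3)%N ->
  classification (nonresidue_X (padic hp) p) (1 :: nonresidue_Y (padic hp) p) 5 4.
Proof.
move=> p3; have op : odd p by rewrite (odd_mod4 p3).
have ns t : reduction (-1 : padic_int hp) != t ^+ 2.
  by rewrite reductionN (reduction_nat _ 1); exact: Fp_nonsquareN1.
have := odd_norm_reps3 (@padic_natr_inj _ hp) (padic_nonsquare_total op ns)
  (padic_nonsquare_aniso_unit ns) (rmorphN1 _).
move=> /norm_reps_classification; rewrite /nonresidue_X /nonresidue_Y p3 /=.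
by rewrite !expr1n !mul1r mulr1.
Qed.

(** * The prime 2 *)

(** The eight square classes of Q_2, kept as integers so that the finite checks run by
    computation. *)
Definition dyadic_reps : seq int := [:: 1; -1; 2; -2; 3; -3; 6; -6].

(** The second twist for -2, 3 and 6, the classes other than -1 for which -1 is a norm; the value 1
    means that there is none. *)
Definition dyadic_twist (y : int) : int :=
  if y == -2 then 3 else if (y == 3) || (y == 6) then 2 else 1.

Definition dyadic_twists : seq (int * int) :=
  [:: (1, 1); (-1, 1); (2, 1); (-2, 1); (3, 1); (-3, 1); (6, 1); (-6, 1);
      (3, 2); (-2, 3); (6, 2)].

(** A nonzero zero over Z_2 can be halved until some coordinate is odd, so excluding these modulo 16
    proves anisotropy. *)
Definition primitive_zero (a b c : int) (x y z : nat) : bool :=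
  (16 %| a * x%:Z ^+ 2 + b * y%:Z ^+ 2 + c * z%:Z ^+ 2)%Z && [|| odd x, odd y | odd z].

(** The third variable is fixed to 0, for otherwise (0, 0, 1) would count as a primitive zero. *)
Definition anisotropic2 (a b : int) : bool :=
  all (fun x => all (fun y => ~~ primitive_zero a b 0 x y 0) (iota 0 16)) (iota 0 16).

Definition anisotropic3 (a b c : int) : bool :=
  all (fun x => all (fun y => all (fun z => ~~ primitive_zero a b c x y z)
    (iota 0 16)) (iota 0 16)) (iota 0 16).

(* Sufficient for m or -m to be a square in Q_2: up to sign, m is 1 modulo 8 or 4 times such a
   number. *)
Definition pm_square (m : int) : bool :=
  ((m %% 8)%Z \in [:: 1; 7]) || ((m %% 32)%Z \in [:: 4; 28]).

(** If the product of t a and a nonzero norm is a square up to sign, then t a is a norm up to sign.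
    The small range for u and v suffices for all classes tested. *)
Definition twist_represents (y a : int) : bool :=
  has (fun t => ((y, t) \in dyadic_twists) &&
    has (fun u => has (fun v => pm_square (t * a * (u%:Z ^+ 2 + y * v%:Z ^+ 2)))
      (iota 0 4)) (iota 0 4)) [:: 1; dyadic_twist y].

(** A relation y' = s^2 y would make (s, 1) a zero of y X^2 - y' Y^2. *)
Lemma dyadic_reps_check :
  all (fun y => all (fun y' => (y == y') || anisotropic2 y (- y')) dyadic_reps) dyadic_reps.
Proof. by vm_compute. Qed.

(** If u^2 + y v^2 were t or -t, then (u, v, 1) would be a zero of one of these two ternary
    forms. *)
Lemma dyadic_twist_check : all (fun l => let t := dyadic_twist l.1 in
  (t == 1) || anisotropic3 1 l.1 (- t) && anisotropic3 1 l.1 t) dyadic_twists.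
Proof. by vm_compute. Qed.

(* The class of -1 is left out: u^2 - v^2 takes every value (difference_of_squares). *)
Lemma dyadic_represents_check :
  all (fun y => (y == -1) || all (twist_represents y) dyadic_reps) dyadic_reps.
Proof. by vm_compute. Qed.

Lemma difference_of_squares (F : fieldType) (a : F) : 2 != 0 :> F ->
  a ^+ 2 = (((a + 1) / 2) ^+ 2 - ((a - 1) / 2) ^+ 2) ^+ 2.
Proof. by move=> two0; field. Qed.

(** If n m is w^2 up to sign for a norm m, then n is m (w / m)^2 up to sign, again a norm. *)
Lemma norm_class_twist (F : fieldType) (y n u v w : F) : w != 0 ->
  (n * (u ^+ 2 + y * v ^+ 2)) ^+ 2 = (w ^+ 2) ^+ 2 ->
  exists u' v', n ^+ 2 = (u' ^+ 2 + y * v' ^+ 2) ^+ 2.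
Proof.
set m := _ + _ => w0 h; have m0 : m != 0.
  apply: contraNneq w0 => m0; suff /eqP : (w ^+ 2) ^+ 2 = 0 by rewrite !sqrf_eq0.
  by rewrite -h m0; ring.
exists (u * (w / m)), (v * (w / m)).
have -> : (u * (w / m)) ^+ 2 + y * (v * (w / m)) ^+ 2 = m * (w / m) ^+ 2 by rewrite /m; ring.
have -> : (m * (w / m) ^+ 2) ^+ 2 = (w ^+ 2) ^+ 2 / m ^+ 2 by field.
by rewrite -h; field.
Qed.

Lemma fourth_power_scale4 (F : fieldType) (l w : F) : 2 != 0 :> F -> w != 0 ->
  l ^+ 2 = (w ^+ 2) ^+ 2 -> exists2 w' : F, w' != 0 & (4 * l) ^+ 2 = (w' ^+ 2) ^+ 2.
Proof.
move=> two0 w0 h; exists (2 * w); first by rewrite mulf_neq0.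
have -> : ((2 * w) ^+ 2) ^+ 2 = 16 * (w ^+ 2) ^+ 2 by ring.
by rewrite -h; ring.
Qed.

(** * Square roots, descent and square classes in Q_2 *)

Section Dyadic.
Variable h2 : prime 2.
Implicit Types x y z u m : padic_int h2.
Let K := padic h2.

Lemma dyadic_int_to_padic (k : int) : (k%:~R : padic_int h2)%:Qp = k%:~R.
Proof. exact: rmorph_int. Qed.

(** Since (1 + 2z)^2 = 1 + 4 (z + z^2), a root is obtained from the fixed point z = 2m - z^2. *)
Lemma dyadic_sqrt m : exists2 w : K, w != 0 & (1 + 8 * m)%:Qp = w ^+ 2.
Proof.
have [z hz] := padic_fixpoint m (-1) 0.
have e : 1 + 8 * m = (1 + 2 * z) ^+ 2.
  have -> : (1 + 2 * z) ^+ 2 = 1 + 4 * (z + z ^+ 2) by ring.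
  have -> : z + z ^+ 2 = 2 * m by rewrite {1}hz; ring.
  by ring.
exists (1 + 2 * z)%:Qp; last by rewrite e rmorphXn.
rewrite to_padic_eq0; apply/eqP => /(congr1 (fun x => residue x 1)).
by rewrite residue_add residue_mul (residue_nat _ 2) (residue_nat _ 1) mul0n mod0n
  (residue_nat _ 0).
Qed.

Lemma dyadic_int_sqrt (k : int) : (k %% 8)%Z = 1 -> exists2 w : K, w != 0 & k%:~R = w ^+ 2.
Proof.
move=> k1; have [w w0 hw] := dyadic_sqrt (k %/ 8)%Z%:~R; exists w => //.
rewrite -hw -dyadic_int_to_padic; congr (_%:Qp).
by rewrite {1}(divz_eq k 8) k1 addrC intrD intrM mulrC.
Qed.

Lemma pm_squareP (k : int) : pm_square k ->
  exists2 w : K, w != 0 & (k%:~R : K) ^+ 2 = (w ^+ 2) ^+ 2.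
Proof.
have pm8 (l : int) : (l %% 8)%Z \in [:: 1; 7] ->
    exists2 w : K, w != 0 & (l%:~R : K) ^+ 2 = (w ^+ 2) ^+ 2.
  rewrite !inE => /orP[] /eqP h.
    by have [w w0 hw] := dyadic_int_sqrt h; exists w; rewrite // hw.
  have [|w w0 hw] := @dyadic_int_sqrt (- l).
    by rewrite (divz_eq l 8) h (_ : - _ = - (l %/ 8)%Z * 8 - 1 * 8 + 1) -?mulrBl ?modzMDl //; ring.
  by exists w => //; rewrite -hw intrN sqrrN.
case/orP; first exact: pm8.
have two0 : 2 != 0 :> K by apply/eqP => /(@padic_natr_inj _ h2 2 0).
move=> h4; have [l kl l8] : exists2 l : int, k = 4 * l & (l %% 8)%Z \in [:: 1; 7].
  move: h4; rewrite !inE => /orP[] /eqP h4.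
    exists ((k %/ 32)%Z * 8 + 1); last by rewrite modzMDl.
    by rewrite {1}(divz_eq k 32) h4; ring.
  exists ((k %/ 32)%Z * 8 + 7); last by rewrite modzMDl.
  by rewrite {1}(divz_eq k 32) h4; ring.
have [w w0 hw] := pm8 _ l8; rewrite kl intrM.
exact: fourth_power_scale4 w0 hw.
Qed.

Lemma dyadic_total (a : K) : a != 0 ->
  exists2 y, y \in [seq c%:~R | c <- dyadic_reps] & exists s, a = s ^+ 2 * y.
Proof.
case/padic_square_class => s [u [b [u1 ->]]].
(* [w] is an inverse of the unit u modulo 8, which makes u w a square. *)
have [w wY [m um]] : exists2 w : int, w \in [:: 1; -1; 3; -3] & exists m, u * w%:~R = 1 + 8 * m.
  have u3 : residue u 3 \in [:: 1; 3; 5; 7]%N.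
    have : odd (residue u 3).
      apply: contraR u1 => ev; rewrite -residue_mod -(residue_lift u 1 2) expn1.
      by rewrite modn2 (negbTE ev).
    have : (residue u 3 < 2 ^ 3)%N by rewrite -residue_mod ltn_mod.
    by case: (residue u 3) => [|[|[|[|[|[|[|[|n]]]]]]]].
  have uE k : residue u 3 = k -> (k < 8)%N -> exists z, u = k%:R + 8 * z.
    move=> uk k8; have /residue_eqP[z ->] : residue u 3 = residue (k%:R : padic_int h2) 3.
      by rewrite residue_nat modn_small.
    by exists z; rewrite -natrX.
  move: u3; rewrite !inE => /or4P[] /eqP /uE[] // z ->.
  - by exists 1 => //; exists z; ring.
  - by exists 3 => //; exists (1 + 3 * z); ring.
  - by exists (-3) => //; exists (-2 - 3 * z); ring.
  - by exists (-1) => //; exists (-1 - z); ring.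
have [v v0 hv] := dyadic_sqrt m.
have w0 : w%:~R != 0 :> K.
  apply: contraNneq v0 => w0; rewrite -sqrf_eq0 -hv -um rmorphM /=.
  by rewrite dyadic_int_to_padic w0 mulr0.
exists (2 ^+ b * w)%:~R.
  by apply: map_f; move: wY; rewrite !inE; case: b => /or4P[] /eqP ->.
exists (s * (v / w%:~R)); rewrite exprMn -[RHS]mulrA; congr (_ * _).
have -> : (2%:R ^+ b * u)%:Qp = 2 ^+ b * u%:Qp by rewrite rmorphM rmorphXn /= rmorph_nat.
have -> : (2 ^+ b * w)%:~R = 2 ^+ b * w%:~R :> K by case: (b); rewrite !(mul1r, intrM).
by apply: square_class_twist => //; rewrite -hv -um rmorphM /= dyadic_int_to_padic.
Qed.

Lemma dvd16 (k : int) m : k%:~R = 2 ^+ 4 * m -> (16 %| k)%Z.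
Proof.
move=> km; have : exists m', (`|k|%N)%:R = 2%:R ^+ 4 * m'.
  case: (intP k) km => [|n|n] km.
  - by exists 0; rewrite mulr0.
  - by exists m; rewrite -km.
  - by exists (- m); rewrite mulrN -km rmorphN opprK abszN.
move/residue_eq0P; rewrite residue_nat => /eqP.
by [].
Qed.

(** The residues at level 4 form a zero modulo 16. As it is not primitive, all coordinates are even
    and can be halved. *)
Lemma primitive_zero_descent (a b c : int) x y z :
  a%:~R * x ^+ 2 + b%:~R * y ^+ 2 + c%:~R * z ^+ 2 = 0 ->
  ~~ primitive_zero a b c (residue x 4) (residue y 4) (residue z 4) ->
  exists x' y' z', [/\ x = 2 * x', y = 2 * y', z = 2 * z' &
    a%:~R * x' ^+ 2 + b%:~R * y' ^+ 2 + c%:~R * z' ^+ 2 = 0].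
Proof.
move=> e; have res4 u : exists u', u = (residue u 4)%:R + 2 ^+ 4 * u'.
  by apply/residue_eqP; rewrite residue_nat residue_mod.
rewrite /primitive_zero negb_and => /orP[/negP[]|].
  have [[x' ex] [y' ey]] := (res4 x, res4 y); have [z' ez] := res4 z.
  rewrite ex ey ez in e.
  apply: (@dvd16 _ (- (a%:~R * (2 * (residue x 4)%:R * x' + 2 ^+ 4 * x' ^+ 2) +
    b%:~R * (2 * (residue y 4)%:R * y' + 2 ^+ 4 * y' ^+ 2) +
    c%:~R * (2 * (residue z 4)%:R * z' + 2 ^+ 4 * z' ^+ 2)))).
  rewrite !intrD !intrM; apply/eqP; rewrite -subr_eq0 -e; apply/eqP; ring.
have odd2 u : ~~ odd (residue u 4) -> exists u', u = 2 * u'.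
  move=> ou; have [u' ->] : exists u', u = 2%:R ^+ 1 * u'; last by exists u'.
  apply/residue_eq0P; rewrite -residue_mod -(residue_lift u 1 3) expn1 modn2.
  by rewrite (negbTE ou).
rewrite !negb_or => /and3P[/odd2[x' ex] /odd2[y' ey] /odd2[z' ez]].
exists x', y', z'; split=> //.
have four0 : 4%:R != 0 :> padic_int h2 by apply/eqP => /(@padic_int_natr_inj _ h2 4 0).
by apply: (mulfI four0); rewrite mulr0 -e ex ey ez; ring.
Qed.

Lemma anisotropic2P (a b : int) (x y : K) : anisotropic2 a b ->
  a%:~R * x ^+ 2 + b%:~R * y ^+ 2 = 0 -> x = 0 /\ y = 0.
Proof.
move=> hab; have [d [x1 [y1 [_ [d0 ex ey _]]]]] := padic_common_denominator x y 0.
have Fd0 : d%:Qp != 0 by rewrite to_padic_eq0.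
move=> e; have e1 : a%:~R * x1 ^+ 2 + b%:~R * y1 ^+ 2 = 0.
  apply/eqP; rewrite -to_padic_eq0 rmorphD (rmorphM _ a%:~R) (rmorphM _ b%:~R) /= !rmorphXn /=.
  rewrite -ex -ey !dyadic_int_to_padic !exprMn [_ * (x ^+ 2 * _)]mulrA [_ * (y ^+ 2 * _)]mulrA.
  by rewrite -mulrDl e mul0r.
suff [x0 y0 _] : [/\ x1 = 0, y1 = 0 & (0 : padic_int h2) = 0].
  by rewrite x0 y0 rmorph0 in ex ey; split; apply: (mulIf Fd0); rewrite mul0r.
(* The binary form enters the ternary descent with the third coordinate held at 0. *)
apply: (@padic_descent _ h2 (fun x y z => a%:~R * x ^+ 2 + b%:~R * y ^+ 2 = 0 /\ z = 0)) => //.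
move=> {x y ex ey e e1} x y z [e ->].
have [|| x' [y' [z' [-> -> z0 e']]]] := @primitive_zero_descent a b 0 x y 0.
- by rewrite mul0r addr0.
- rewrite (_ : residue 0 4 = 0%N) ?(residue_nat _ 0) //.
  have res16 u : residue u 4 \in iota 0 16 by rewrite mem_iota -residue_mod ltn_mod.
  by move/allP: hab => /(_ _ (res16 x))/allP/(_ _ (res16 y)).
exists x', y', 0; rewrite mulr0; split=> //; split=> //.
by move: e'; rewrite mul0r addr0.
Qed.

Lemma anisotropic3P (a b c : int) (x y z : K) : anisotropic3 a b c ->
  a%:~R * x ^+ 2 + b%:~R * y ^+ 2 + c%:~R * z ^+ 2 = 0 -> [/\ x = 0, y = 0 & z = 0].
Proof.
move=> habc; rewrite -!dyadic_int_to_padic; apply: padic_anisotropic => {x y z}.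
apply: padic_descent => x y z e; apply: (primitive_zero_descent e).
have res16 u : residue u 4 \in iota 0 16 by rewrite mem_iota -residue_mod ltn_mod.
by move/allP: habc => /(_ _ (res16 x))/allP/(_ _ (res16 y))/allP/(_ _ (res16 z)).
Qed.

Lemma dyadic_reps_square (y y' : int) (s : K) : y \in dyadic_reps -> y' \in dyadic_reps ->
  y'%:~R = s ^+ 2 * y%:~R -> y' = y.
Proof.
move=> hy hy' e; apply/eqP; rewrite eq_sym.
have /allP/(_ _ hy)/allP/(_ _ hy')/orP[//|/anisotropic2P h] := dyadic_reps_check.
have [_ /eqP] := h s 1 ltac:(by rewrite intrN e; ring).
by rewrite oner_eq0.
Qed.

Lemma dyadic_intr_inj : injective (intr : int -> K).
Proof.
move=> m n /eqP; rewrite -subr_eq0 -intrB => /eqP e; apply/eqP; rewrite -subr_eq0.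
case: (m - n) e => k; first by move/(@padic_natr_inj _ h2 k 0)->.
by rewrite NegzE intrN => /eqP; rewrite oppr_eq0 => /eqP/(@padic_natr_inj _ h2 k.+1 0).
Qed.

Lemma dyadic_norm_reps : norm_reps [seq c%:~R : K | c <- dyadic_reps]
  [seq (l.1%:~R, l.2%:~R) | l <- dyadic_twists].
Proof.
have two0 : 2 != 0 :> K by apply/eqP => /(@padic_natr_inj _ h2 2 0).
have Linj : injective (fun l : int * int => (l.1%:~R : K, l.2%:~R : K)).
  by move=> [a b] [c d] /= [/dyadic_intr_inj -> /dyadic_intr_inj ->].
split.
- exact: padic_natr_inj.
- by rewrite map_inj_uniq //; exact: dyadic_intr_inj.
- by rewrite -[0](mulr0z 1) mem_map //; exact: dyadic_intr_inj.
- exact: dyadic_total.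
- move=> _ _ s /mapP[y hy ->] /mapP[y' hy' ->] e.
  by rewrite (dyadic_reps_square hy hy' e).
- by rewrite map_inj_uniq.
- move=> _ _ /mapP[[y t] hl [-> ->]].
  have : all (fun l : int * int => (l.1 \in dyadic_reps) && (l.2 != 0)) dyadic_twists by [].
  move/allP/(_ _ hl)/andP => [hy ht]; split; first exact: map_f.
  by rewrite -[0](mulr0z 1) (inj_eq dyadic_intr_inj).
- move=> _ _ /mapP[y hy ->] /mapP[a ha ->].
  have /allP/(_ _ hy)/orP[/eqP ->|/allP/(_ _ ha)] := dyadic_represents_check.
    exists 1, ((a%:~R + 1) / 2), ((a%:~R - 1) / 2); split; first exact: (map_f _ (x := (-1, 1))).
    by rewrite mul1r intrN mulN1r difference_of_squares.
  case/hasP => t _ /andP[hl /hasP[u _ /hasP[v _ /pm_squareP[w w0 hw]]]].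
  have hw' : (t%:~R * a%:~R * (u%:~R ^+ 2 + y%:~R * v%:~R ^+ 2)) ^+ 2 = (w ^+ 2) ^+ 2.
    by rewrite -hw; congr (_ ^+ 2); rewrite !(expr2, intrM, intrD).
  have [u' [v' e]] := norm_class_twist w0 hw'.
  by exists t%:~R, u', v'; split; [exact: (map_f _ hl)|].
(* [dyadic_twist] carried over to Q_2, as [twist_pair_norm] expects a function on the field. *)
pose tw (k : K) : K := if k == -2 then 3 else if (k == 3) || (k == 6) then 2 else 1.
have twE (y : int) : tw y%:~R = (dyadic_twist y)%:~R.
  rewrite /tw -[-2 : K]/((-2)%:~R) -[3 : K]/(3%:~R) -[6 : K]/(6%:~R) !(inj_eq dyadic_intr_inj).
  by rewrite /dyadic_twist; case: ifP => // _; case: ifP.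
apply: (@twist_pair_norm _ tw).
  move=> _ _ /mapP[[y t] hl [-> ->]]; rewrite twE.
  have : all (fun l : int * int => (l.2 == 1) || (l.2 == dyadic_twist l.1)) dyadic_twists by [].
  by move/allP/(_ _ hl)/orP => -[] /eqP /= ->; [left|right].
move=> _ _ u v /mapP[[y t] hl [-> _]]; rewrite twE -[1 in X in X -> _](mulr1z 1).
rewrite (inj_eq dyadic_intr_inj) => /negPf tw1.
have := allP dyadic_twist_check _ hl; rewrite /= tw1 /= => /andP[an ap].
rewrite eqf_sqr; apply/negP => /orP[] /eqP e.
  have [|_ _ /eqP] := anisotropic3P (x := u) (y := v) (z := 1) an; last by rewrite oner_eq0.
  by rewrite mul1r e intrN expr1n mulr1 subrr.
have [|_ _ /eqP] := anisotropic3P (x := u) (y := v) (z := 1) ap; last by rewrite oner_eq0.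
by rewrite mul1r e expr1n mulr1 addNr.
Qed.

End Dyadic.

Lemma padic_classification2 p (hp : prime p) : p = 2%N ->
  classification (nonresidue_X (padic hp) p) (1 :: nonresidue_Y (padic hp) p) 11 8.
Proof.
move=> p2; subst p; have := norm_reps_classification (dyadic_norm_reps hp).
rewrite -map_comp.
have -> : [seq ((fun l : padic hp * padic hp => l.2 ^+ 2 * l.1) \o
    (fun l : int * int => (l.1%:~R, l.2%:~R))) l | l <- dyadic_twists] =
  [seq (l.2 ^+ 2 * l.1)%:~R | l <- dyadic_twists].
  by apply: eq_map => l /=; rewrite intrM rmorphXn.
by [].
Qed.

(** * The real numbers *)

(** One twist per class suffices: for y = 1 the norms are the positive numbers and the sign covers
    the rest, and u^2 - v^2 takes every value. *)
Lemma real_norm_reps (R : rcfType) : norm_reps [:: 1; -1 : R] [:: (1, 1); (-1, 1)].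
Proof.
have neg (s : R) : -1 != s ^+ 2.
  by apply/eqP => e; have := sqr_ge0 s; rewrite -e oppr_ge0 ler10.
have nN : (1 : R) != -1 by rewrite eq_sym -[X in _ != X](expr1n _ 2).
split.
- by move=> m n /eqP; rewrite eqr_nat => /eqP.
- by rewrite /= inE nN.
- by rewrite !inE negb_or eq_sym oner_eq0 eq_sym oppr_eq0 oner_eq0.
- move=> a; rewrite neq_lt => /orP[a0|a0].
    exists (-1); rewrite ?inE ?eqxx ?orbT //; exists (Num.sqrt (- a)).
    by rewrite sqr_sqrtr ?oppr_ge0 ?ltW // mulrN1 opprK.
  by exists 1; rewrite ?inE ?eqxx //; exists (Num.sqrt a); rewrite sqr_sqrtr ?mulr1 ?ltW.
- move=> y y' s; rewrite !inE => /orP[] /eqP -> /orP[] /eqP -> // /eqP.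
    by rewrite mulr1 (negPf (neg s)).
  by rewrite mulrN1 eq_sym eqr_oppLR eq_sym (negPf (neg s)).
- by rewrite /= inE xpair_eqE (negPf nN).
- by move=> y t; rewrite !inE !xpair_eqE => /orP[] /andP[/eqP -> /eqP ->];
    rewrite eqxx ?orbT oner_eq0.
- move=> y a; rewrite !inE => hy ha; exists 1, 1, 0.
  split; first by rewrite !inE !xpair_eqE eqxx !andbT.
  by case/orP: ha => /eqP ->; ring.
- move=> y t t' u v; rewrite !inE !xpair_eqE.
  by move=> /orP[] /andP[_ /eqP ->] /orP[] /andP[_ /eqP ->].
Qed.

Theorem theorem3p11 (p : nat) (hp : prime p) (R : realType) :
  let X := nonresidue_X (padic hp) p in
  let Y := nonresidue_Y (padic hp) p in
  [/\ (p %% 4 = 1)%N -> classification X (1 :: Y) 7 4,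
      (p %% 4 = 3)%N -> classification X (1 :: Y) 5 4,
      p = 2%N -> classification X (1 :: Y) 11 8
    & classification [:: 1; -1 : R] [:: 1; -1 : R] 2 2].
Proof.
split.
- exact: padic_classification1.
- exact: padic_classification3.
- exact: padic_classification2.
have := norm_reps_classification (real_norm_reps R).
by rewrite /= !expr1n !mul1r.
Qed.
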